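(* Let $\mathcal{H}$ be a Hilbert space, let $\Phi$ be a unital positive linear map from $\mathbb{B}(\mathcal{H})$ to a unital $C^*$-algebra, and let $A,B\in\mathbb{B}(\mathcal{H})$ be two positive operators such that $0<mI\le A\le m'I\le M'I\le B\le MI$ for real scalars $m,m',M',M$. Put $h=\frac{M}{m}$ and $K(h)=\frac{(h+1)^2}{4h}$. Then $$\Phi^2\!\left(\frac{A+B}{2}\right)\le\frac{K^2(h)}{\left(1+\frac{\left(\log\frac{M'}{m'}\right)^2}{8}\right)^2}\,\Phi^2(A\#B)$$ and $$\Phi^2\!\left(\frac{A+B}{2}\right)\le\frac{K^2(h)}{\left(1+\frac{\left(\log\frac{M'}{m'}\right)^2}{8}\right)^2}\,\bigl(\Phi(A)\#\Phi(B)\bigr)^2 .$$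
   Context: $\mathbb{B}(\mathcal{H})$ is the $C^*$-algebra of all bounded linear operators on the Hilbert space $\mathcal{H}$ and $I$ is the identity operator. $A\ge 0$ means that $A$ is positive, and $A\ge B$ means $A-B\ge 0$. A linear map $\Phi$ between $C^*$-algebras is positive if $\Phi(A)\ge0$ whenever $A\ge 0$, and unital if $\Phi(I)=I$. $\Phi^2(T)$ denotes $(\Phi(T))^2$ and $K^2(h)$ denotes $(K(h))^2$. For positive invertible $A,B$, the geometric mean is $A\#B=A^{1/2}\left(A^{-1/2}BA^{-1/2}\right)^{1/2}A^{1/2}$. *)

(* Defs.v *)
From HB Require Import structures.
From mathcomp Require Import all_boot all_order all_algebra.
From mathcomp Require Import complex.
From mathcomp Require Import boolp classical_sets functions reals topology.
From mathcomp Require Import normedtype.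

Set Implicit Arguments.
Unset Strict Implicit.
Unset Printing Implicit Defensive.

Import Order.TTheory GRing.Theory Num.Theory.
Import numFieldNormedType.Exports.

Local Open Scope classical_set_scope.
Local Open Scope ring_scope.
Local Open Scope complex_scope.

(* A complex Hilbert space: the norm of the complete normed module is the one
   induced by the inner product (linear in its first argument), which makes
   the latter positive definite. *)
HB.mixin Record isHilbert (R : realType) H of CompleteNormedModule R[i] H := {
  inner : H -> H -> R[i];
  innerDZl : forall (a : R[i]) x y z,
    inner (a *: x + y) z = a * inner x z + inner y z;
  innerC : forall x y, inner y x = Num.conj (inner x y);
  innerxx : forall x, inner x x = `|x| ^+ 2 }.

#[short(type="hilbertType")]
HB.structure Definition Hilbert (R : realType) :=
  {H of CompleteNormedModule R[i] H & isHilbert R H}.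

(* A unital C*-algebra. The zero algebra is allowed: it is the algebra of
   bounded operators on the zero Hilbert space. The multiplication is part of
   the mixin because no structure can inherit both from normed modules and from
   rings (such a join would have to be declared below [Num.NumDomain]); the
   ring structure is derived right afterwards, so that [a * b] and [1] are
   [cmul a b] and [cone]. *)
HB.mixin Record isCstarAlgebra (R : realType) A
    of CompleteNormedModule R[i] A := {
  cmul : A -> A -> A;
  cone : A;
  cmulA : associative cmul;
  cmul1l : left_id cone cmul;
  cmul1r : right_id cone cmul;
  cmulDl : left_distributive cmul +%R;
  cmulDr : right_distributive cmul +%R;
  cmulZl : forall (c : R[i]) a b, cmul (c *: a) b = c *: cmul a b;
  cmulZr : forall (c : R[i]) a b, cmul a (c *: b) = c *: cmul a b;
  cmul_norm : forall a b, `|cmul a b| <= `|a| * `|b|;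
  star : A -> A;
  starK : involutive star;
  starDZ : forall (c : R[i]) a b,
    star (c *: a + b) = Num.conj c *: star a + star b;
  starM : forall a b, star (cmul a b) = cmul (star b) (star a);
  cstar_norm : forall a, `|cmul (star a) a| = `|a| ^+ 2 }.

#[short(type="cstarAlgType")]
HB.structure Definition CstarAlgebra (R : realType) :=
  {A of CompleteNormedModule R[i] A & isCstarAlgebra R A}.

HB.instance Definition _ (R : realType) (A : cstarAlgType R) :=
  GRing.Zmodule_isPzRing.Build (CstarAlgebra.sort A)
    cmulA cmul1l cmul1r cmulDl cmulDr.

Section BoundedOperators.
Variables (R : realType) (H : hilbertType R).

Definition bounded_op : {pred (H -> H)} := fun f =>
  `[< linear f /\ exists k : R, forall x, `|f x| <= k%:C * `|x| >].

Lemma bounded_opP (f : H -> H) :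
  reflect (linear f /\ exists k : R, forall x, `|f x| <= k%:C * `|x|)
          (f \in bounded_op).
Proof. exact: asboolP. Qed.

Lemma bounded_op_submod : submod_closed bounded_op.
Proof.
split.
  apply/bounded_opP; split; first by move=> a x y /=; rewrite scaler0 addr0.
  by exists 0 => x; rewrite normr0 mul0r.
move=> a f g /bounded_opP[lf [k kf]] /bounded_opP[lg [l lg']].
apply/bounded_opP; split.
  move=> b x y.
  change (a *: f (b *: x + y) + g (b *: x + y)
          = b *: (a *: f x + g x) + (a *: f y + g y)).
  rewrite lf lg !scalerDr !scalerA (mulrC a b) -!addrA; congr (_ + _).
  by rewrite addrCA.
exists (complex.Re `|a| * k + l) => x.
change (`|a *: f x + g x| <= (complex.Re `|a| * k + l)%:C * `|x|).
have -> : (complex.Re `|a| * k + l)%:C = `|a| * k%:C + l%:C.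
  by rewrite rmorphD rmorphM /=; congr (_ * _ + _); apply: RRe_real; exact: normr_real.
apply: le_trans (ler_normD _ _) _; rewrite normrZ mulrDl lerD //.
by rewrite -mulrA ler_wpM2l.
Qed.

HB.instance Definition _ :=
  GRing.isSubmodClosed.Build R[i] (H -> H) bounded_op bounded_op_submod.

Record bop := Bop { bop_val :> H -> H; bop_valP : bop_val \in bounded_op }.

HB.instance Definition _ := [isSub for bop_val].
HB.instance Definition _ := [Choice of bop by <:].
HB.instance Definition _ := [SubChoice_isSubLmodule of bop by <:].

Lemma bop_eqP (A B : bop) : (forall x, A x = B x) -> A = B.
Proof. by move=> AB; apply/val_inj/funext. Qed.

Lemma bop_linear (A : bop) : linear A.
Proof. by have /bounded_opP[] := bop_valP A. Qed.

Lemma bop_id_subproof : @idfun H \in bounded_op.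
Proof.
by apply/bounded_opP; split=> //; exists 1 => x; rewrite mul1r.
Qed.

Lemma bop_comp_subproof (A B : bop) : (A \o B) \in bounded_op.
Proof.
have /bounded_opP[_ [k kA]] := bop_valP A.
have /bounded_opP[_ [l lB]] := bop_valP B.
apply/bounded_opP; split; first by move=> a x y /=; rewrite !bop_linear.
exists (`|k| * l) => x /=.
apply: le_trans (kA _) _; rewrite rmorphM /= -mulrA.
apply: (@le_trans _ _ (`|k|%:C * `|B x|)).
  by rewrite ler_wpM2r // lecR ler_norm.
by rewrite ler_wpM2l // ler0c.
Qed.

Definition bop_one := Bop bop_id_subproof.
Definition bop_mul (A B : bop) := Bop (bop_comp_subproof A B).

Lemma bop_mulA : associative bop_mul.
Proof. by move=> A B C; apply: bop_eqP. Qed.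
Lemma bop_mul1l : left_id bop_one bop_mul.
Proof. by move=> A; apply: bop_eqP. Qed.
Lemma bop_mul1r : right_id bop_one bop_mul.
Proof. by move=> A; apply: bop_eqP. Qed.
Lemma bop_mulDl : left_distributive bop_mul +%R.
Proof. by move=> A B C; apply: bop_eqP. Qed.
Lemma bop_mulDr : right_distributive bop_mul +%R.
Proof.
move=> A B C; apply: bop_eqP => x.
change (A (B x + C x) = A (B x) + A (C x)).
by have := bop_linear A 1 (B x) (C x); rewrite !scale1r.
Qed.

HB.instance Definition _ := GRing.Zmodule_isPzRing.Build bop
  bop_mulA bop_mul1l bop_mul1r bop_mulDl bop_mulDr.

(* On R[i], [0 <= z] says that z is real and nonnegative. Positivity of an
   operator is that of its quadratic form; this agrees with the spectral
   definition [cstar_ge0] used below for abstract C*-algebras. *)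
Definition bop_ge0 : set bop := [set A | forall x, 0 <= inner (A x) x].

Definition bop_le (A B : bop) := bop_ge0 (B - A).

End BoundedOperators.

Section InverseAndGeometricMean.
Variable T : pzRingType.

Definition is_inverse (a b : T) := a * b = 1 /\ b * a = 1.

Definition invertible (a : T) := exists b, is_inverse a b.

Definition rinv (a : T) : T := xget a (is_inverse a).

(* The [xget] definitions below have a junk default outside of their domain.
   [pos] is the set of positive elements of T; a positive operator, and more
   generally a positive element of a C*-algebra, has exactly one positive
   square root. *)
Definition psqrt (pos : set T) (a : T) : T :=
  xget 0 [set b | pos b /\ b ^+ 2 = a].

Definition gmean (pos : set T) (a b : T) : T :=
  let s := psqrt pos a in s * psqrt pos (rinv s * b * rinv s) * s.

End InverseAndGeometricMean.

Section CstarOrder.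
Variables (R : realType) (U : cstarAlgType R).

Definition spectrum (a : U) : set R[i] :=
  [set z | ~ invertible (z *: (1 : U) - a)].

Definition cstar_ge0 : set U :=
  [set a | star a = a /\ spectrum a `<=` [set z | 0 <= z]].

Definition cstar_le (a b : U) := cstar_ge0 (b - a).

End CstarOrder.

Definition positive_map (R : realType) (H : hilbertType R)
    (U : cstarAlgType R) (Phi : bop H -> U) :=
  forall A, bop_ge0 A -> cstar_ge0 (Phi A).

Definition bop_gmean (R : realType) (H : hilbertType R) (A B : bop H) : bop H :=
  gmean (@bop_ge0 R H) A B.

Definition cstar_gmean (R : realType) (U : cstarAlgType R) (a b : U) : U :=
  gmean (@cstar_ge0 R U) a b.

Definition kantorovich (R : realType) (h : R) : R := (h + 1) ^+ 2 / (4 * h).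

(* Main.v *)
Require Import Defs.
From HB Require Import structures.
From mathcomp Require Import all_boot all_order all_algebra.
From mathcomp Require Import complex ring lra.
From mathcomp Require Import boolp classical_sets functions reals topology.
From mathcomp Require Import normedtype sequences derive realfun exp.

(* Write [r = 1 + ln (M' / m') ^ 2 / 8], [X = Phi ((A + B) / 2)], and let [Y] be
   either [Phi (A # B)] or [Phi A # Phi B]. As [cosh x >= 1 + x ^ 2 / 2], the
   spectral gap between [A] and [B] gives
   [A^-1 + B^-1 >= 2 r (A # B)^-1], and likewise for [Phi A] and [Phi B]. With
   [A + M m A^-1 <= M + m], the same for [B], and Choi's inequality
   [Phi (G)^-1 <= Phi (G^-1)], this leads to [X + M m r Y^-1 <= M + m] in both
   cases. It then remains to see that [X + k Y^-1 <= t] implies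
   [X ^ 2 <= (t ^ 2 / (4 k)) ^ 2 Y ^ 2]. For [t = 2], [k = 1] the Lyapunov
   expression [Y (Y ^ 2 - X ^ 2) + (Y ^ 2 - X ^ 2) Y] is a sum of terms
   [c * p * c] with [c] self-adjoint and [p] one of [X], [Y^-1], [X + Y^-1] and
   [2 - (X + Y^-1)], so [Y ^ 2 - X ^ 2 >= 0] by Lyapunov's theorem.

   Choi's inequality only requires positivity of [Phi] on the polynomials in
   [G^-1] times [G]; the spectral measure of [G^-1] is replaced by a random walk
   (a disguised form of Bernstein polynomials). Positivity in a C*-algebra is
   handled by square roots of the elements [1 - x], [|x| < 1], obtained as fixed
   points of contractions, without functional calculus. *)

Set Implicit Arguments.
Unset Strict Implicit.
Unset Printing Implicit Defensive.

Import Order.TTheory GRing.Theory Num.Theory.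
Import numFieldNormedType.Exports.

Local Open Scope classical_set_scope.
Local Open Scope ring_scope.
Local Open Scope complex_scope.

(** * Reflexive identities in noncommutative algebras *)

Section NcRing.
Variables (K : comPzRingType) (T : pzRingType) (sc : {rmorphism K -> T}).
Hypothesis scC : forall c x, x * sc c = sc c * x.

Inductive nc_expr :=
  | NcZero | NcOne | NcScalar of K | NcVar of nat | NcAdd of nc_expr & nc_expr
  | NcMul of nc_expr & nc_expr | NcOpp of nc_expr.

Variable v : seq T.

Fixpoint nc_eval (e : nc_expr) : T :=
  match e with
  | NcZero => 0
  | NcOne => 1
  | NcScalar c => sc c
  | NcVar n => nth 0 v n
  | NcAdd e f => nc_eval e + nc_eval f
  | NcMul e f => nc_eval e * nc_eval f
  | NcOpp e => - nc_eval e
  end.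

(** A private copy of equality on [nat], as [nc_cat] is of concatenation: [nc_compute] can unfold
    exactly these and leave the operations on coefficients alone. *)
Fixpoint nc_eqn (m n : nat) : bool :=
  match m, n with
  | 0, 0 => true
  | m'.+1, n'.+1 => nc_eqn m' n'
  | _, _ => false
  end.

Fixpoint nc_eqw (s t : seq nat) : bool :=
  match s, t with
  | [::], [::] => true
  | i :: s', j :: t' => if nc_eqn i j then nc_eqw s' t' else false
  | _, _ => false
  end.

Fixpoint nc_word (w : seq nat) : T :=
  if w is i :: w' then nth 0 v i * nc_word w' else 1.

Fixpoint nc_poly (p : seq (K * seq nat)) : T :=
  if p is (c, w) :: p' then sc c * nc_word w + nc_poly p' else 0.

(* [((i, j), (c, w))] stands for the rewriting rule
   [v_i * v_j = c * v_w]. *)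
Definition nc_rule := (nat * nat * (K * seq nat))%type.

Fixpoint nc_valid (rs : seq nc_rule) : Prop :=
  if rs is ((i, j), (c, w)) :: rs' then
    nth 0 v i * nth 0 v j = sc c * nc_word w /\ nc_valid rs'
  else True.

Fixpoint nc_find (rs : seq nc_rule) (i j : nat) : option (K * seq nat) :=
  if rs is ((i', j'), r) :: rs' then
    if nc_eqn i i' then if nc_eqn j j' then Some r else nc_find rs' i j
    else nc_find rs' i j
  else None.

Fixpoint nc_cat (s t : seq nat) : seq nat :=
  if s is i :: s' then i :: nc_cat s' t else t.

Fixpoint nc_step (rs : seq nc_rule) (w : seq nat) : option (K * seq nat) :=
  if w is i :: w' then
    if w' is j :: w'' then
      match nc_find rs i j with
      | Some (c, u) => Some (c, nc_cat u w'')
      | None =>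
          match nc_step rs w' with
          | Some (c, u) => Some (c, i :: u)
          | None => None
          end
      end
    else None
  else None.

(** Fuel replaces a termination argument for the rules. Every intermediate result is correct, so
    running out only leaves terms uncollected. *)
Fixpoint nc_reduce (fuel : nat) (rs : seq nc_rule) (c : K) (w : seq nat) :=
  if fuel is fuel'.+1 then
    match nc_step rs w with
    | Some (d, u) => nc_reduce fuel' rs (c * d) u
    | None => (c, w)
    end
  else (c, w).

Fixpoint nc_insert (c : K) (w : seq nat) (p : seq (K * seq nat)) :=
  if p is (d, u) :: p' then
    if nc_eqw w u then (c + d, u) :: p' else (d, u) :: nc_insert c w p'
  else [:: (c, w)].

Fixpoint nc_add (p q : seq (K * seq nat)) :=
  if p is (c, w) :: p' then nc_insert c w (nc_add p' q) else q.

Fixpoint nc_mul1 rs (c : K) (w : seq nat) (q : seq (K * seq nat)) :=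
  if q is (d, u) :: q' then
    let: (e, t) := nc_reduce 100 rs (c * d) (nc_cat w u) in
    nc_insert e t (nc_mul1 rs c w q')
  else [::].

Fixpoint nc_mul rs (p q : seq (K * seq nat)) :=
  if p is (c, w) :: p' then nc_add (nc_mul1 rs c w q) (nc_mul rs p' q)
  else [::].

Fixpoint nc_opp (p : seq (K * seq nat)) :=
  if p is (c, w) :: p' then (- c, w) :: nc_opp p' else [::].

Fixpoint nc_norm rs (e : nc_expr) : seq (K * seq nat) :=
  match e with
  | NcZero => [::]
  | NcOne => [:: (1, [::])]
  | NcScalar c => [:: (c, [::])]
  | NcVar n => [:: (1, [:: n])]
  | NcAdd e f => nc_add (nc_norm rs e) (nc_norm rs f)
  | NcMul e f => nc_mul rs (nc_norm rs e) (nc_norm rs f)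
  | NcOpp e => nc_opp (nc_norm rs e)
  end.

(** A proposition and not a boolean, since the coefficients live in an abstract ring: its conjuncts
    become goals for [ring] and [field]. *)
Fixpoint nc_zero (p : seq (K * seq nat)) : Prop :=
  if p is (c, _) :: p' then c = 0 /\ nc_zero p' else True.

Lemma nc_eqnP m n : nc_eqn m n -> m = n.
Proof. by elim: m n => [|m IH] [|n] //= /IH ->. Qed.

Lemma nc_eqwP s t : nc_eqw s t -> s = t.
Proof.
elim: s t => [|i s IH] [|j t] //=.
by case: ifP => // /nc_eqnP -> /IH ->.
Qed.

Lemma nc_catE s t : nc_word (nc_cat s t) = nc_word s * nc_word t.
Proof. by elim: s => [|i s IH] /=; rewrite ?mul1r // IH mulrA. Qed.

Lemma nc_findP rs i j c w : nc_valid rs -> nc_find rs i j = Some (c, w) ->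
  nth 0 v i * nth 0 v j = sc c * nc_word w.
Proof.
elim: rs => [|[[i' j'] [d u]] rs IH] //= [rij /IH{}IH].
case: ifP => [/nc_eqnP ii|_]; last exact: IH.
by case: ifP => [/nc_eqnP jj [<- <-]|_]; [rewrite ii jj | exact: IH].
Qed.

Lemma nc_stepP rs w c u : nc_valid rs -> nc_step rs w = Some (c, u) ->
  nc_word w = sc c * nc_word u.
Proof.
move=> rsP; elim: w c u => [|i [|j w] IH] c u //.
change (match nc_find rs i j with
      | Some (c, u) => Some (c, nc_cat u w)
      | None =>
          match nc_step rs (j :: w) with
          | Some (c, u) => Some (c, i :: u)
          | None => None
          end
      end = Some (c, u) -> nth 0 v i * nc_word (j :: w) = sc c * nc_word u).
case E: (nc_find rs i j) => [[d t]|].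
  move=> [<- <-]; rewrite nc_catE mulrA -(nc_findP rsP E) /= !mulrA.
  by [].
case E': (nc_step rs (j :: w)) => [[d t]|] // [<- <-].
by rewrite (IH _ _ E') /= !mulrA scC.
Qed.

Lemma nc_reduceP n rs c w : nc_valid rs ->
  let: (d, u) := nc_reduce n rs c w in sc d * nc_word u = sc c * nc_word w.
Proof.
move=> rsP; elim: n c w => [|n IH] c w //=.
case E: (nc_step rs w) => [[d u]|] //.
move: (IH (c * d) u); case: nc_reduce => e t ->.
by rewrite (nc_stepP rsP E) rmorphM mulrA.
Qed.

Lemma nc_insertE c w p : nc_poly (nc_insert c w p) = sc c * nc_word w + nc_poly p.
Proof.
elim: p => [|[d u] p IH] //=; case: ifP => [/nc_eqwP ->|_] /=.
  by rewrite rmorphD mulrDl addrA.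
by rewrite IH addrCA.
Qed.

Lemma nc_addE p q : nc_poly (nc_add p q) = nc_poly p + nc_poly q.
Proof.
by elim: p => [|[c w] p IH] /=; rewrite ?add0r // nc_insertE IH addrA.
Qed.

Lemma nc_mul1E rs c w q : nc_valid rs ->
  nc_poly (nc_mul1 rs c w q) = sc c * nc_word w * nc_poly q.
Proof.
move=> rsP; elim: q => [|[d u] q IH]; first by rewrite /= mulr0.
rewrite -[nc_mul1 rs c w _]/(let: (e, t) := nc_reduce 100 rs (c * d) (nc_cat w u) in
  nc_insert e t (nc_mul1 rs c w q)).
move: (nc_reduceP 100 (c * d) (nc_cat w u) rsP); case: nc_reduce => e t et.
rewrite nc_insertE IH et nc_catE rmorphM /= mulrDr; congr (_ + _).
rewrite -!mulrA; congr (_ * _); rewrite mulrA [in RHS]mulrA; congr (_ * _).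
by rewrite scC.
Qed.

Lemma nc_mulE rs p q : nc_valid rs ->
  nc_poly (nc_mul rs p q) = nc_poly p * nc_poly q.
Proof.
move=> rsP; elim: p => [|[c w] p IH] /=; first by rewrite mul0r.
by rewrite nc_addE nc_mul1E // IH mulrDl.
Qed.

Lemma nc_normE rs e : nc_valid rs -> nc_poly (nc_norm rs e) = nc_eval e.
Proof.
move=> rsP; elim: e => [||c|n|e IHe f IHf|e IHe f IHf|e IHe] /=.
- by [].
- by rewrite rmorph1 mulr1 addr0.
- by rewrite mulr1 addr0.
- by rewrite rmorph1 mul1r mulr1 addr0.
- by rewrite nc_addE IHe IHf.
- by rewrite nc_mulE // IHe IHf.
rewrite -IHe; elim: (nc_norm rs e) => [|[c w] p IH] /=; first by rewrite oppr0.
by rewrite IH rmorphN mulNr opprD.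
Qed.

Lemma nc_correct rs e f : nc_valid rs ->
  nc_zero (nc_norm rs (NcAdd e (NcOpp f))) -> nc_eval e = nc_eval f.
Proof.
move=> rsP z; apply/eqP; rewrite -subr_eq0; apply/eqP.
rewrite -[LHS]/(nc_eval (NcAdd e (NcOpp f))) -(nc_normE _ rsP).
elim: (nc_norm _ _) z => [|[c w] p IH] //= [-> /IH ->].
by rewrite rmorph0 mul0r addr0.
Qed.

End NcRing.

(** Inverse pairs, commuting variables (sorted so that the first index comes first) and square roots
    of -1. *)
Inductive nc_spec := NcInv of nat & nat | NcCom of nat & nat | NcImag of nat.

Fixpoint nc_rules (K : comPzRingType) (s : seq nc_spec) : seq (nc_rule K) :=
  match s with
  | [::] => [::]
  | NcInv i j :: s' =>
      ((i, j), (1, [::])) :: ((j, i), (1, [::])) :: nc_rules K s'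
  | NcCom i j :: s' => ((j, i), (1, [:: i; j])) :: nc_rules K s'
  | NcImag i :: s' => ((i, i), (- 1, [::])) :: nc_rules K s'
  end.

Ltac nc_index x l :=
  lazymatch l with
  | x :: _ => constr:(0%N)
  | _ :: ?l' => let n := nc_index x l' in constr:(n.+1)
  end.

Ltac nc_reify K sc l e :=
  lazymatch e with
  | @GRing.add _ ?a ?b =>
      let a' := nc_reify K sc l a in let b' := nc_reify K sc l b in
      constr:(NcAdd a' b')
  | @GRing.mul _ ?a ?b =>
      let a' := nc_reify K sc l a in let b' := nc_reify K sc l b in
      constr:(NcMul a' b')
  | @GRing.opp _ ?a => let a' := nc_reify K sc l a in constr:(NcOpp a')
  | @GRing.zero _ => constr:(@NcZero K)
  | @GRing.one _ => constr:(@NcOne K)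
  | GRing.RMorphism.sort _ ?c => constr:(NcScalar (c : K))
  | _ => let n := nc_index e l in constr:(@NcVar K n)
  end.

Ltac nc_compute :=
  cbv beta iota zeta delta [nc_zero nc_norm nc_add nc_mul nc_mul1 nc_opp
    nc_insert nc_rules nc_reduce nc_step nc_find nc_cat nc_eqn nc_eqw].

(** * Complete operator algebras *)

(* The part of the structure of a C*-algebra that involves only self-adjoint
   elements, which both an abstract C*-algebra and the bounded operators on a
   Hilbert space carry (the latter without constructing adjoints). *)
Record opalg (R : realType) (T : pzRingType) := Opalg {
  sc : {rmorphism R -> T};
  scC : forall c x, x * sc c = sc c * x;
  im : T;
  imC : forall x, x * im = im * x;
  imM : im * im = - 1;
  nrm : T -> R;
  nrm_ge0 : forall x, 0 <= nrm x;
  nrm_eq0 : forall x, nrm x = 0 -> x = 0;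
  nrmD : forall x y, nrm (x + y) <= nrm x + nrm y;
  nrmM : forall x y, nrm (x * y) <= nrm x * nrm y;
  nrm_sc : forall c, nrm (sc c) <= `|c|;
  nrm_im : nrm im <= 1;
  sa : T -> Prop;
  sa_sc : forall c, sa (sc c);
  saD : forall x y, sa x -> sa y -> sa (x + y);
  sa_jordan : forall x y, sa x -> sa y -> sa (x * y + y * x);
  sa_lie : forall x y, sa x -> sa y -> sa (im * (x * y - y * x));
  sa_inv : forall x y, sa x -> is_inverse x y -> sa y;
  sa_lim : forall x, (forall e, 0 < e -> exists y, sa y /\ nrm (x - y) <= e) ->
    sa x;
  nrm_normal : forall x y, sa x -> sa y -> x * y = y * x ->
    nrm (x + im * y) ^+ 2 <= nrm (x * x + y * y);
  complete : forall (y : nat -> T) C r, 0 <= r < 1 ->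
    (forall n, nrm (y n.+1 - y n) <= C * r ^+ n) ->
    exists l, forall e, 0 < e -> exists N, forall n, (N <= n)%N ->
      nrm (l - y n) <= e }.

Ltac nc_side :=
  first [ done
        | rewrite /= ?rmorphN ?rmorph1 ?mulr1 ?mul1r ?mulN1r //;
          first [ done | assumption | symmetry; assumption | exact: imC | exact: imM
                | symmetry; exact: imC ] ].

(** [l] lists the variables and [rs] the relations between them; what remains is one scalar equation
    per word. *)
Ltac nc_ring A l rs :=
  rewrite ?expr2;
  lazymatch goal with
  | |- @eq ?T ?a ?b =>
      lazymatch type of A with
      | opalg ?R _ =>
          let a' := nc_reify (Real.sort R) (sc A) l a in
          let b' := nc_reify (Real.sort R) (sc A) l b in
          change (nc_eval (sc A) l a' = nc_eval (sc A) l b');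
          apply: (@nc_correct _ _ (sc A) (scC A) l (nc_rules _ rs) a' b');
          [ do ![split]; nc_side | nc_compute; do ![split] ]
      end
  end.

(** * Inverses in a noncommutative ring *)

Section Inverse.
Variable T : pzRingType.
Implicit Types x y z : T.

Lemma is_inverse_sym x y : is_inverse x y -> is_inverse y x.
Proof. by case. Qed.

Lemma is_inverse_uniq x y z : is_inverse x y -> is_inverse x z -> y = z.
Proof. by move=> [_ yx] [xz _]; rewrite -[y]mulr1 -xz mulrA yx mul1r. Qed.

Lemma is_inverseM x y x' y' :
  is_inverse x x' -> is_inverse y y' -> is_inverse (x * y) (y' * x').
Proof.
move=> [xx' x'x] [yy' y'y]; split.
  by rewrite mulrA -(mulrA x) yy' mulr1.
by rewrite mulrA -(mulrA y') x'x mulr1.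
Qed.

Lemma invertibleM x y : invertible x -> invertible y -> invertible (x * y).
Proof. by move=> [x' xx'] [y' yy']; exists (y' * x'); exact: is_inverseM. Qed.

(** The inverse [z] of [x * y] commutes with [x], because [x * y] does; hence [y * z] is an inverse
    of [x] on both sides. *)
Lemma invertible_commM x y : x * y = y * x -> invertible (x * y) ->
  invertible x.
Proof.
move=> xy [z [z1 z2]]; exists (y * z); split; first by rewrite mulrA.
have zx : z * x = x * z.
  rewrite -[LHS]mulr1 -{1}z1.
  have -> : z * x * (x * y * z) = z * (x * (y * x)) * z by rewrite -xy !mulrA.
  by rewrite (mulrA x) (mulrA z) z2 mul1r.
by rewrite -mulrA zx mulrA -xy.
Qed.

(* Jacobson's lemma *)
Lemma invertible_1addC x y : invertible (1 + x * y) -> invertible (1 + y * x).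
Proof.
move=> [z [z1 z2]]; exists (1 - y * z * x); split.
  rewrite mulrBr mulr1 mulrDl mul1r.
  have -> : y * x * (y * z * x) = y * (x * y * z) * x by rewrite !mulrA.
  have -> : x * y * z = 1 - z by rewrite -z1 mulrDl mul1r addrAC subrr add0r.
  by rewrite mulrBr mulr1 mulrBl [X in _ - X]addrC subrK addrK.
rewrite mulrBl mul1r mulrDr mulr1.
have -> : y * z * x * (y * x) = y * (z * (x * y)) * x by rewrite !mulrA.
have -> : z * (x * y) = 1 - z by rewrite -z2 mulrDr mulr1 addrAC subrr add0r.
by rewrite mulrBr mulr1 mulrBl [X in _ - X]addrC subrK addrK.
Qed.

End Inverse.

(** * Norm estimates, contractions and Neumann series *)

Section SelfAdjoint.
Variables (R : realType) (T : pzRingType) (A : opalg R T).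
Local Notation sc := (sc A).
Local Notation im := (im A).
Local Notation nrm := (nrm A).
Local Notation sa := (sa A).
Implicit Types (a b c r t : R) (x y z d s p q : T).

Lemma nrm_scM c x : nrm (sc c * x) <= `|c| * nrm x.
Proof. exact: le_trans (nrmM _ _ _) (ler_wpM2r (nrm_ge0 _ _) (nrm_sc _ _)). Qed.

Lemma nrm1 : nrm 1 <= 1.
Proof. by have := nrm_sc A 1; rewrite rmorph1 normr1. Qed.

Lemma nrmN x : nrm (- x) = nrm x.
Proof.
have le y : nrm (- y) <= nrm y.
  by have := nrm_scM (-1) y; rewrite rmorphN1 mulN1r normrN normr1 mul1r.
by apply/eqP; rewrite eq_le le /= -{1}[x]opprK le.
Qed.

Lemma nrmB x y : nrm (x - y) <= nrm x + nrm y.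
Proof. by rewrite -(nrmN y); exact: nrmD. Qed.

Lemma nrmBC x y : nrm (x - y) = nrm (y - x).
Proof. by rewrite -nrmN opprB. Qed.

Lemma nrmBD x y z : nrm (x - z) <= nrm (x - y) + nrm (y - z).
Proof. by apply: le_trans (nrmD _ _ _); rewrite addrA subrK. Qed.

Lemma nrm_sub0 x y : (forall e, 0 < e -> nrm (x - y) <= e) -> x = y.
Proof.
move=> xy; apply/eqP; rewrite -subr_eq0; apply/eqP/(nrm_eq0 (o:=A)).
apply/eqP; rewrite eq_le nrm_ge0 andbT; apply/ler_addgt0Pr => e e0.
by rewrite add0r xy.
Qed.

Definition nrm_closed (P : T -> Prop) :=
  forall x, (forall e, 0 < e -> exists y, P y /\ nrm (x - y) <= e) -> P x.

Lemma closed_comm d : nrm_closed (fun x => d * x = x * d).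
Proof.
move=> x xP; apply: nrm_sub0 => e e0.
have d0 := nrm_ge0 A d.
have k0 : 0 < 2 * nrm d + 1 by lra.
have [y [dy xy]] := xP (e / (2 * nrm d + 1)) (divr_gt0 e0 k0).
have -> : d * x - x * d = d * (x - y) - (x - y) * d.
  by rewrite mulrBr mulrBl dy opprB addrA subrK.
apply: le_trans (nrmB _ _) _.
have := nrmM A d (x - y); have := nrmM A (x - y) d.
have := ler_wpM2l d0 xy.
have : nrm d * (e / (2 * nrm d + 1)) <= e / 2.
  rewrite mulrA ler_pdivrMr //; nra.
lra.
Qed.

Lemma closed_ball b : nrm_closed (fun x => nrm x <= b).
Proof.
move=> x xP; apply/ler_addgt0Pr => e e0; have [y [yb xy]] := xP e e0.
by have := nrmD A (x - y) y; rewrite subrK; lra.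
Qed.

(** Contraction principle, iterating from 0. Closed properties preserved by [f] on the ball pass to
    the limit: fixed points inherit norm bounds, commutation and self-adjointness in this way. *)
Lemma fixpoint (f : T -> T) b r : 0 <= b -> 0 <= r < 1 ->
    (forall x, nrm x <= b -> nrm (f x) <= b) ->
    (forall x y, nrm x <= b -> nrm y <= b ->
       nrm (f x - f y) <= r * nrm (x - y)) ->
  exists2 x, f x = x & forall P : T -> Prop, nrm_closed P -> P 0 ->
    (forall y, nrm y <= b -> P y -> P (f y)) -> P x.
Proof.
move=> b0 r01 fb fr.
have nrm0 : nrm 0 = 0.
  apply/eqP; rewrite eq_le nrm_ge0 andbT.
  by have := nrm_sc A 0; rewrite rmorph0 normr0.
pose y n := iter n f 0.
have yb n : nrm (y n) <= b by elim: n => [|n IH] /=; [rewrite nrm0 | exact: fb].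
have yr n : nrm (y n.+1 - y n) <= nrm (f 0) * r ^+ n.
  elim: n => [|n IH]; first by rewrite /= subr0 expr0 mulr1.
  apply: le_trans (fr (y n.+1) (y n) (yb _) (yb _)) _.
  by rewrite exprS mulrCA ler_wpM2l //; case/andP: r01.
have [l ly] := complete r01 yr.
have lP (P : T -> Prop) : nrm_closed P -> P 0 ->
    (forall y, nrm y <= b -> P y -> P (f y)) -> P l.
  move=> Pc P0 Pf; apply: Pc => e e0; have [N yN] := ly e e0.
  exists (y N); split; last exact: yN.
  by elim: N {yN} => [//|n IH]; exact: Pf.
exists l => //; apply: nrm_sub0 => e e0.
have lb : nrm l <= b.
  by apply: (lP _ (@closed_ball b)) => [|z zb _]; [rewrite nrm0 | exact: fb].
have [N yN] := ly (e / 2) (divr_gt0 e0 (ltr0Sn _ 1)).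
have := yN N (leqnn _); have := yN N.+1 (leqnSn _).
have := nrmBD (f l) (y N.+1) l; have := fr _ _ lb (yb N).
rewrite -[f (y N)]/(y N.+1) (nrmBC (y N.+1) l).
have := nrm_ge0 A (l - y N).
nra.
Qed.

(** The inverse is the fixed point of [y |-> 1 + x * y]. It commutes with [x] since all iterates do,
    which makes it two-sided. *)
Lemma neumann x r : 0 <= r < 1 -> nrm x <= r ->
  exists2 y, is_inverse (1 - x) y & nrm y <= (1 - r)^-1.
Proof.
move=> r01 xr; set b := (1 - r)^-1.
have r0 : 0 <= r by case/andP: r01.
have b1 : b * (1 - r) = 1 by apply: mulVf; lra.
have b0 : 0 <= b by rewrite invr_ge0; lra.
have x0 := nrm_ge0 A x.
have [||y yx yP] := @fixpoint (fun y => 1 + x * y) b r b0 r01.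
- move=> y yb; apply: le_trans (nrmD _ _ _) _.
  have := nrm1; have := nrmM A x y; have := nrm_ge0 A y; nra.
- move=> y z _ _; rewrite opprD addrACA subrr add0r -mulrBr.
  by apply: le_trans (nrmM _ _ _) _; rewrite ler_wpM2r ?nrm_ge0.
exists y; last first.
  apply: (yP _ (@closed_ball b)) => [|z zb _].
    by have := nrm_sc A 0; rewrite rmorph0 normr0; lra.
  apply: le_trans (nrmD _ _ _) _.
  have := nrm1; have := nrmM A x z; have := nrm_ge0 A z; nra.
have xy : x * y = y * x.
  apply: (yP _ (@closed_comm x)); first by rewrite mulr0 mul0r.
  by move=> z _ xz; rewrite mulrDr mulrDl mulr1 mul1r xz mulrA xz.
have e : y - x * y = 1 by rewrite -{1}yx addrK.
by split; [rewrite mulrBl mul1r | rewrite mulrBr mulr1 -xy].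
Qed.

Lemma is_inverse_sc c : c != 0 -> is_inverse (sc c) (sc c^-1).
Proof. by move=> c0; split; rewrite -rmorphM ?divff ?mulVf // rmorph1. Qed.

Lemma invertible_sc c : c != 0 -> invertible (sc c).
Proof. by move/is_inverse_sc; exists (sc c^-1). Qed.

Lemma invertible_scB t x : nrm x < t -> invertible (sc t - x).
Proof.
move=> xt; have t0 : 0 < t := le_lt_trans (nrm_ge0 A x) xt.
have -> : sc t - x = sc t * (1 - sc t^-1 * x).
  by rewrite mulrBr mulr1 mulrA -rmorphM divff ?gt_eqF // rmorph1 mul1r.
apply: invertibleM; first by apply: invertible_sc; rewrite gt_eqF.
have [||y y1 _] := @neumann (sc t^-1 * x) (t^-1 * nrm x); last by exists y.
  rewrite mulr_ge0 ?invr_ge0 ?(ltW t0) ?nrm_ge0 //=.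
  by rewrite mulrC ltr_pdivrMr // mul1r.
by apply: le_trans (nrm_scM _ _) _; rewrite ger0_norm // invr_ge0 (ltW t0).
Qed.

Lemma invertible_perturb x y z : is_inverse x y -> nrm z * nrm y <= 2^-1 ->
  exists2 y', is_inverse (x + z) y' & nrm y' <= 2 * nrm y.
Proof.
move=> xy zy; have [||u u1 u2] := @neumann (- (y * z)) 2^-1.
- lra.
- by rewrite nrmN; apply: le_trans (nrmM _ _ _) _; rewrite mulrC.
have -> : x + z = x * (1 - - (y * z)).
  by rewrite opprK mulrDr mulr1 mulrA xy.1 mul1r.
exists (u * y); first exact: is_inverseM.
apply: le_trans (nrmM _ _ _) _; rewrite ler_wpM2r ?nrm_ge0 //.
by apply: le_trans u2 _; rewrite le_eqVlt; apply/orP; left; apply/eqP; field.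
Qed.

(** * Self-adjoint elements *)

Lemma sa1 : sa 1. Proof. by rewrite -(rmorph1 sc); exact: sa_sc. Qed.
Lemma sa0 : sa 0. Proof. by rewrite -(rmorph0 sc); exact: sa_sc. Qed.

(** [opalg] only provides Jordan products: [x * y] is that of [x / 2] and [y], and [x / 2] is that
    of [x] and [1 / 4]. *)
Lemma sa_commM x y : sa x -> sa y -> x * y = y * x -> sa (x * y).
Proof.
move=> sx sy xy.
have -> : x * y = sc 2^-1 * x * y + y * (sc 2^-1 * x).
  by nc_ring A [:: x; y] [:: NcCom 0 1]%N; field.
apply: sa_jordan => //.
have -> : sc 2^-1 * x = sc 4^-1 * x + x * sc 4^-1.
  by nc_ring A [:: x; y] (@nil nc_spec); field.
by apply: sa_jordan => //; exact: sa_sc.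
Qed.

Lemma sa_scM c x : sa x -> sa (sc c * x).
Proof. by move=> sx; apply: sa_commM => //; [exact: sa_sc | rewrite scC]. Qed.

Lemma saN x : sa x -> sa (- x).
Proof. by move/(sa_scM (-1)); rewrite rmorphN1 mulN1r. Qed.

Lemma saB x y : sa x -> sa y -> sa (x - y).
Proof. by move=> sx /saN; exact: saD. Qed.

Lemma sa_sqr x : sa x -> sa (x * x).
Proof. by move=> sx; exact: sa_commM. Qed.

(** The Jordan triple product: [y * x * y] is a combination of iterated Jordan products. *)
Lemma sa_conj x y : sa x -> sa y -> sa (y * x * y).
Proof.
move=> sx sy; pose j := x * y + y * x.
have -> : y * x * y = sc 2^-1 * ((j * y + y * j) - ((y * y) * x + x * (y * y))).
  by rewrite /j; nc_ring A [:: x; y] (@nil nc_spec); field.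
apply: sa_scM; apply: saB; first by do 2?apply: sa_jordan.
by apply: sa_jordan => //; exact: sa_sqr.
Qed.

(* Fixed point of [y |-> (x + y ^+ 2) / 2], so that [(1 - y) ^+ 2 = 1 - x]. *)
Lemma sqrt_1sub x r : 0 <= r < 1 -> sa x -> nrm x <= r ->
  exists s, [/\ sa s, s * s = 1 - x, nrm (1 - s) <= r &
    forall d, d * x = x * d -> d * s = s * d].
Proof.
move=> r01 sx xr; have r0 : 0 <= r by case/andP: r01.
pose f y := sc 2^-1 * (x + y * y).
have fb y : nrm y <= r -> nrm (f y) <= r.
  move=> yr; apply: le_trans (nrm_scM _ _) _; rewrite ger0_norm ?invr_ge0 //.
  have := nrmD A x (y * y); have := nrmM A y y; have := nrm_ge0 A y; nra.
have fr y z : nrm y <= r -> nrm z <= r -> nrm (f y - f z) <= r * nrm (y - z).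
  move=> yr zr; rewrite /f -mulrBr opprD addrACA subrr add0r.
  apply: le_trans (nrm_scM _ _) _; rewrite ger0_norm ?invr_ge0 //.
  have -> : y * y - z * z = y * (y - z) + (y - z) * z.
    by rewrite mulrBr mulrBl addrA subrK.
  have := nrmD A (y * (y - z)) ((y - z) * z).
  have := nrmM A y (y - z); have := nrmM A (y - z) z; have := nrm_ge0 A (y - z).
  nra.
have [y yf yP] := fixpoint r0 r01 fb fr.
have nrm0 : nrm 0 <= 0 by have := nrm_sc A 0; rewrite rmorph0 normr0.
exists (1 - y); split.
- apply: saB; first exact: sa1; apply: (yP sa (@sa_lim _ _ A)); first exact: sa0.
  by move=> z _ sz; apply: sa_scM; apply: saD => //; exact: sa_sqr.
- have -> : (1 - y) * (1 - y) = 1 - (sc 2 * y - y * y).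
    by nc_ring A [:: y] (@nil nc_spec); ring.
  transitivity (1 - (sc 2 * f y - y * y)); first by rewrite yf.
  by rewrite /f; nc_ring A [:: x; y] (@nil nc_spec); field.
- have -> : 1 - (1 - y) = y by rewrite opprB addrC subrK.
  by apply: (yP _ (@closed_ball r)) => [|z zr _]; [exact: le_trans nrm0 _ | exact: fb].
- move=> d dx; rewrite mulrBr mulrBl mulr1 mul1r; congr (_ - _).
  apply: (yP _ (@closed_comm d)); first by rewrite mulr0 mul0r.
  move=> z _ dz; rewrite /f.
  by nc_ring A [:: d; x; z] [:: NcCom 0 1; NcCom 0 2]%N; ring.
Qed.

(** The spectrum of a self-adjoint element is real. Writing [x + im * c] as [y + im * w] with [w]
    far out on the imaginary axis gives [nrm y < |w|], and a Neumann series applies. *)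
Lemma invertible_addim x c : sa x -> c != 0 -> invertible (x + im * sc c).
Proof.
move=> sx c0.
have c2 : 0 < c ^+ 2 by rewrite exprn_even_gt0.
pose k := nrm x ^+ 2 / c ^+ 2; have kc : k * c ^+ 2 = nrm x ^+ 2.
  by rewrite /k divfK // gt_eqF.
have k0 : 0 <= k by rewrite divr_ge0 ?sqr_ge0.
(* As [nrm x ^ 2 = k * c ^ 2], the bound for normal elements gives
   [nrm y ^ 2 <= k * (1 + k) * c ^ 2 < w ^ 2]. *)
pose w := (1 + k) * c; have w0 : w != 0 by rewrite mulf_neq0 // gt_eqF //; lra.
pose y := x + im * sc (- k * c).
have yw : nrm y < `|w|.
  rewrite -(ltr_pXn2r (ltn0Sn 1)) ?nnegrE ?nrm_ge0 // real_normK ?num_real //.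
  apply: le_lt_trans (nrm_normal sx (sa_sc _ _) (scC _ _ _)) _.
  apply: le_lt_trans (nrmD _ _ _) _; rewrite -rmorphM.
  have := nrmM A x x; have := nrm_sc A (- k * c * (- k * c)).
  rewrite ger0_norm; last by rewrite -expr2 sqr_ge0.
  rewrite /w; nra.
have w0' : 0 < `|w| by rewrite normr_gt0.
have [||z z1 _] := @neumann (im * sc w^-1 * y) (`|w|^-1 * nrm y).
- rewrite mulr_ge0 ?invr_ge0 ?nrm_ge0 //=.
  by rewrite mulrC ltr_pdivrMr ?mul1r.
- apply: le_trans (nrmM _ _ _) _; rewrite ler_wpM2r ?nrm_ge0 //.
  apply: le_trans (nrmM _ _ _) _; rewrite -normfV.
  have := nrm_im A; have := nrm_sc A w^-1; have := nrm_ge0 A im.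
  have := nrm_ge0 A (sc w^-1); nra.
have -> : x + im * sc c = im * sc w * (1 - im * sc w^-1 * y).
  have -> : y = x + im * sc (c - w) by rewrite /y /w; congr (_ + _ * sc _); ring.
  by nc_ring A [:: im; x] [:: NcImag 0; NcCom 0 1]%N; field.
apply: invertibleM; last by exists z.
exists (- im * sc w^-1); split.
  by nc_ring A [:: im] [:: NcImag 0]%N; field.
by nc_ring A [:: im] [:: NcImag 0]%N; field.
Qed.

End SelfAdjoint.

(** * Norm and spectrum of a self-adjoint element *)

Section Positive.
Variables (R : realType) (T : pzRingType) (A : opalg R T).
Local Notation sc := (sc A).
Local Notation im := (im A).
Local Notation nrm := (nrm A).
Local Notation sa := (sa A).
Implicit Types (a b c r t : R) (x y z d s p q : T).

Lemma comm_inverse d x x' : is_inverse x x' -> d * x = x * d -> d * x' = x' * d.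
Proof.
move=> [xx' x'x] dx; rewrite -[LHS]mul1r -x'x -mulrA (mulrA x) -dx -mulrA xx'.
by rewrite mulr1.
Qed.

(** Choose [y] and [w] with [y ^ 2 = 1 - d ^ 2] and [w ^ 2 = 1 - h / k], [k = c + 1]. Then
    [d ^ 2 + (y * w) ^ 2 = 1 - 1 / k], so the normal elements [d + im * (y * w)] and
    [d - im * (y * w)], whose mean is [d], have squared norm at most [1 - 1 / k]. *)
Lemma nrm_sqr_le_gap d h c : sa d -> nrm d < 1 -> is_inverse (1 - d * d) h ->
  nrm h <= c -> nrm d ^+ 2 <= 1 - (c + 1)^-1.
Proof.
move=> sd d1 hd hc; have c0 : 0 <= c := le_trans (nrm_ge0 _ _) hc.
have d0 := nrm_ge0 A d.
have [|||y [sy yy _ yC]] := @sqrt_1sub _ _ A (d * d) (nrm d ^+ 2).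
- by apply/andP; split; [exact: sqr_ge0 | rewrite expr_lt1].
- exact: sa_sqr.
- by rewrite expr2; exact: nrmM.
have dy : d * y = y * d by apply: yC; rewrite mulrA.
have [y' y'y] : invertible y.
  by apply: (@invertible_commM _ y y) => //; rewrite yy; exists h.
have y'y'h : y' * y' = h.
  by have := is_inverseM y'y y'y; rewrite yy => /is_inverse_uniq; apply.
have sy' : sa y' by apply: sa_inv y'y.
(* Any [k > c] makes [h / k] of norm less than 1, so that [1 - h / k] has a square root. *)
set k := c + 1; have k0 : 0 < k by rewrite /k; lra.
pose u := (Num.sqrt k)^-1; pose e := sc u * y'.
have uu : u * u = k^-1 by rewrite -invfM -expr2 sqr_sqrtr ?ltW.
have ee : e * e = sc k^-1 * h.
  rewrite /e -y'y'h -uu.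
  by nc_ring A [:: y'] (@nil nc_spec); ring.
have hC z : z * y = y * z -> z * (e * e) = e * e * z.
  move=> zy; rewrite ee -y'y'h.
  have zy' := comm_inverse y'y zy.
  by nc_ring A [:: z; y'] [:: NcCom 0 1]%N; ring.
have [|||w [sw ww _ wC]] := @sqrt_1sub _ _ A (e * e) (c / k).
- by rewrite divr_ge0 ?(ltW k0) //= ltr_pdivrMr ?mul1r // /k; lra.
- by rewrite ee; apply: sa_scM; rewrite -y'y'h; exact: sa_sqr.
- rewrite ee; apply: le_trans (nrm_scM _ _ _) _.
  by rewrite ger0_norm ?invr_ge0 ?(ltW k0) // mulrC ler_pM2r // invr_gt0.
have yw : y * w = w * y by apply: wC; exact: hC.
have dw : d * w = w * d by apply: wC; exact: hC.
have syw : sa (y * w) by exact: sa_commM.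
have dyw : d * (y * w) = y * w * d by rewrite mulrA dy -mulrA dw mulrA.
have sum : d * d + y * w * (y * w) = sc (1 - k^-1).
  have -> : y * w * (y * w) = (y * y) * (w * w).
    by nc_ring A [:: y; w] [:: NcCom 0 1]%N; ring.
  rewrite yy ww ee mulrBr mulr1 (mulrA _ (sc _)) scC -mulrA hd.1 mulr1.
  by rewrite addrA (addrC (d * d)) subrK rmorphB rmorph1.
have nsum : nrm (d * d + y * w * (y * w)) <= 1 - k^-1.
  rewrite sum; apply: le_trans (nrm_sc _ _) _; rewrite ger0_norm //.
  by rewrite subr_ge0 invf_le1 // /k; lra.
have n1 := le_trans (nrm_normal sd syw dyw) nsum.
have n2 : nrm (d - im * (y * w)) ^+ 2 <= 1 - k^-1.
  rewrite -mulrN; apply: le_trans (nrm_normal sd (saN syw) _) _.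
    by rewrite mulrN mulNr dyw.
  by rewrite mulrNN.
have : nrm d <= (nrm (d + im * (y * w)) + nrm (d - im * (y * w))) / 2.
  have {1}-> : d = sc 2^-1 * ((d + im * (y * w)) + (d - im * (y * w))).
    by nc_ring A [:: d; im; y; w] (@nil nc_spec); field.
  apply: le_trans (nrm_scM _ _ _) _; rewrite ger0_norm ?invr_ge0 // mulrC.
  by rewrite ler_pM2r ?invr_gt0 //; exact: nrmD.
move: n1 n2 d0; set n := nrm (_ + _); set n' := nrm (_ - _) => n1 n2 d0 dn.
have : nrm d ^+ 2 <= ((n + n') / 2) ^+ 2 by rewrite ler_pXn2r ?nnegrE //; lra.
have := sqr_ge0 (n - n'); lra.
Qed.

Lemma nrm_scE c x : 0 < c -> nrm (sc c * x) = c * nrm x.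
Proof.
move=> c0; apply/eqP; rewrite eq_le; apply/andP; split.
  by apply: le_trans (nrm_scM _ _ _) _; rewrite gtr0_norm.
rewrite -ler_pdivlMl //.
have := nrm_scM A c^-1 (sc c * x).
by rewrite mulrA -rmorphM mulVf ?gt_eqF // rmorph1 mul1r gtr0_norm ?invr_gt0.
Qed.

(* A self-adjoint element of norm 1 has 1 or -1 in its spectrum. *)
Lemma nrm1_not_invertible d : sa d -> nrm d = 1 -> ~ invertible (1 - d * d).
Proof.
move=> sd d1 [h hd]; have h0 := nrm_ge0 A h.
(* Shrinking [d] to [(1 - e) * d] at most doubles the bound on the inverse. The gap lemma then gives
   [(1 - e) ^ 2 <= 1 - 1 / (2 * nrm h + 1)], which fails for this [e]. *)
pose e : R := (8 * nrm h + 8)^-1.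
have e0 : 0 < e by rewrite invr_gt0; lra.
have eh : e * (8 * nrm h + 8) = 1 by rewrite mulVf // gt_eqF //; lra.
have e1 : e < 1 by nra.
have [|k kd kh] := @invertible_perturb _ _ A _ h (sc (1 - (1 - e) ^+ 2) * (d * d)) hd.
  have := nrm_scM A (1 - (1 - e) ^+ 2) (d * d).
  have := nrmM A d d; rewrite d1 ger0_norm; last by nra.
  have := nrm_ge0 A (d * d); have := nrm_ge0 A (sc (1 - (1 - e) ^+ 2) * (d * d)).
  nra.
have de : 1 - d * d + sc (1 - (1 - e) ^+ 2) * (d * d)
        = 1 - sc (1 - e) * d * (sc (1 - e) * d).
  by nc_ring A [:: d] (@nil nc_spec); ring.
rewrite de in kd.
have := @nrm_sqr_le_gap (sc (1 - e) * d) k _ (sa_scM _ sd) _ kd kh.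
rewrite nrm_scE ?subr_gt0 // d1 mulr1 => /(_ ltac:(lra)).
set g := (_ + 1)^-1; have : g * (2 * nrm h + 1) = 1.
  by rewrite mulVf // gt_eqF //; lra.
have : 0 < g by rewrite invr_gt0; lra.
nra.
Qed.

(** * Positive elements *)

(** No strictly negative number lies in the spectrum; non-real ones are excluded by
    [invertible_addim]. *)
Definition pos x := sa x /\ forall t, 0 < t -> invertible (sc t + x).

(** With [nrm_pos], a characterization of positivity by the norm, from which sums of positive
    elements are positive. If [s = nrm (t - x) > t], then [d = (t - x) / s] has norm 1, yet
    [1 - d ^ 2] has the invertible factors [s - t + x] and [s + t - x]. *)
Lemma pos_nrm x t : pos x -> nrm x <= t -> nrm (sc t - x) <= t.
Proof.
move=> [sx px] xt; rewrite leNgt; apply/negP => ts.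
set s := nrm _ in ts; have x0 := nrm_ge0 A x.
have s0 : 0 < s by lra.
apply: (@nrm1_not_invertible (sc s^-1 * (sc t - x))).
- by apply: sa_scM; apply: saB => //; exact: sa_sc.
- by rewrite nrm_scE ?invr_gt0 // mulVf // gt_eqF.
have -> : 1 - sc s^-1 * (sc t - x) * (sc s^-1 * (sc t - x)) =
    sc (s ^- 2) * ((sc (s - t) + x) * (sc (s + t) - x)).
  by nc_ring A [:: x] (@nil nc_spec); field; rewrite ?gt_eqF.
apply: invertibleM; first by apply: invertible_sc; rewrite invr_eq0 expf_neq0 // gt_eqF.
apply: invertibleM; first by apply: px; rewrite subr_gt0.
by apply: invertible_scB; lra.
Qed.

Lemma nrm_pos x t : sa x -> nrm (sc t - x) <= t -> pos x.
Proof.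
move=> sx xt; split=> // e e0.
have -> : sc e + x = sc (e + t) - (sc t - x) by nc_ring A [:: x] (@nil nc_spec); ring.
by apply: invertible_scB; lra.
Qed.

Lemma pos_sub x t : sa x -> nrm x <= t -> pos (sc t - x).
Proof.
move=> sx xt; apply: (@nrm_pos _ t); first by apply: saB => //; exact: sa_sc.
by rewrite opprB addrC subrK.
Qed.

Lemma posD x y : pos x -> pos y -> pos (x + y).
Proof.
move=> px py; apply: (@nrm_pos _ (nrm x + nrm y)).
  by apply: saD; [exact: px.1 | exact: py.1].
rewrite rmorphD opprD addrACA; apply: le_trans (nrmD _ _ _) _.
by apply: lerD; exact: pos_nrm.
Qed.

Lemma pos_sc c : 0 <= c -> pos (sc c).
Proof.
move=> c0; split=> [|t t0]; first exact: sa_sc.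
by rewrite -rmorphD; apply: invertible_sc; rewrite gt_eqF //; lra.
Qed.

Lemma pos0 : pos 0.
Proof. by rewrite -(rmorph0 sc); exact: pos_sc. Qed.

Lemma pos_scM c x : 0 <= c -> pos x -> pos (sc c * x).
Proof.
rewrite le_eqVlt => /orP[/eqP<- _|c0 px]; first by rewrite rmorph0 mul0r; exact: pos0.
split=> [|t t0]; first by apply: sa_scM; exact: px.1.
have -> : sc t + sc c * x = sc c * (sc (t / c) + x).
  by nc_ring A [:: x] (@nil nc_spec); field; rewrite ?gt_eqF.
apply: invertibleM; first by apply: invertible_sc; rewrite gt_eqF.
by apply: px.2; rewrite divr_gt0.
Qed.

Lemma pos_limit x : sa x -> (forall e, 0 < e -> pos (x + sc e)) -> pos x.
Proof.
move=> sx px; split=> // t t0; have t2 : 0 < t / 2 by lra.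
have -> : sc t + x = sc (t / 2) + (x + sc (t / 2)).
  by nc_ring A [:: x] (@nil nc_spec); field.
exact: (px _ t2).2.
Qed.

Lemma pos_limit_bound x y : sa x -> sa y ->
  (forall e, 0 < e -> pos (x + sc e * y)) -> pos x.
Proof.
move=> sx sy px; apply: pos_limit => // e e0; have y0 := nrm_ge0 A y.
have k0 : 0 < nrm y + 1 by lra.
have e'0 : 0 < e / (nrm y + 1) by exact: divr_gt0.
have -> : x + sc e = (x + sc (e / (nrm y + 1)) * y)
    + sc (e / (nrm y + 1)) * (sc (nrm y + 1) - y).
  by nc_ring A [:: x; y] (@nil nc_spec); field; rewrite ?gt_eqF.
apply: posD; first exact: px.
apply: pos_scM; first exact: ltW.
by apply: pos_sub => //; lra.
Qed.

(** [t + x ^ 2] is the product of [x + im * sqrt t] and [x - im * sqrt t]. *)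
Lemma pos_sqr x : sa x -> pos (x * x).
Proof.
move=> sx; split=> [|t t0]; first exact: sa_sqr.
have -> : sc t + x * x = (x + im * sc (Num.sqrt t)) * (x + im * sc (- Num.sqrt t)).
  rewrite -{1}(sqr_sqrtr (ltW t0)).
  by nc_ring A [:: im; x] [:: NcImag 0; NcCom 0 1]%N; ring.
have t1 : Num.sqrt t != 0 by rewrite gt_eqF // sqrtr_gt0.
by apply: invertibleM; apply: invertible_addim; rewrite ?oppr_eq0.
Qed.

Lemma spos_invertible p c : 0 < c -> pos (p - sc c) -> invertible p.
Proof. by move=> c0 [_ /(_ _ c0)]; rewrite addrC subrK. Qed.

Lemma spos_pos p c : 0 <= c -> pos (p - sc c) -> pos p.
Proof. by move=> c0 /posD/(_ (pos_sc c0)); rewrite subrK. Qed.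

(** With [n = nrm (p - c)] and [t = n + c], the element [p / t] is within [n / t < 1] of 1, where
    [sqrt_1sub] applies. *)
Lemma pos_sqrt p c : 0 < c -> pos (p - sc c) ->
  exists s, [/\ pos s, s * s = p & forall d, d * p = p * d -> d * s = s * d].
Proof.
move=> c0 pp; have n0 := nrm_ge0 A (p - sc c).
have := pos_nrm pp (lexx _); set n := nrm _ in n0 *.
set t := n + c; have t0 : 0 < t by rewrite /t; lra.
have -> : sc n - (p - sc c) = sc t - p by rewrite /t rmorphD opprB addrA.
move=> tp; have sp : sa p := (spos_pos (ltW c0) pp).1.
have r1 : 0 <= n / t < 1.
  by rewrite divr_ge0 ?(ltW t0) //= ltr_pdivrMr // mul1r /t; lra.
have [||s [ss s2 s1 sC]] := @sqrt_1sub _ _ A (sc t^-1 * (sc t - p)) (n / t) r1.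
- by apply: sa_scM; apply: saB => //; exact: sa_sc.
- by rewrite nrm_scE ?invr_gt0 // mulrC ler_pM2r ?invr_gt0.
exists (sc (Num.sqrt t) * s); split.
- apply: pos_scM; first exact: sqrtr_ge0.
  apply: (@nrm_pos _ 1) => //; rewrite rmorph1; apply: le_trans s1 _.
  by apply: ltW; case/andP: r1.
- have -> : sc (Num.sqrt t) * s * (sc (Num.sqrt t) * s)
      = sc (Num.sqrt t ^+ 2) * (s * s).
    by nc_ring A [:: s] (@nil nc_spec); ring.
  rewrite s2 sqr_sqrtr ?(ltW t0) //.
  by nc_ring A [:: p] (@nil nc_spec); field; rewrite ?gt_eqF.
- move=> d dp; have ds : d * s = s * d.
    by apply: sC; nc_ring A [:: d; p] [:: NcCom 0 1]%N; ring.
  by nc_ring A [:: d; s] [:: NcCom 0 1]%N; ring.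
Qed.

(** With [k = e - t^-1], [e + p' - t^-1] is [p' * (1 + k * p)]. If [k < 0], then [- k^-1 > t], and
    [1 + k * p] is [- k] times [(- k^-1 - t) + (t - p)]. *)
Lemma pos_inverse p p' t : pos p -> is_inverse p p' -> 0 < t ->
  pos (sc t - p) -> pos (p' - sc t^-1).
Proof.
move=> pp pp' t0 pt; have [pp1 p'p1] := pp'; split=> [|e e0].
  by apply: saB; [apply: sa_inv pp'; exact: pp.1 | exact: sa_sc].
have -> : sc e + (p' - sc t^-1) = p' * (1 + sc (e - t^-1) * p).
  by nc_ring A [:: p; p'] [:: NcInv 0 1]%N; ring.
apply: invertibleM; first by exists p; exact: is_inverse_sym.
set k := e - t^-1.
have [k0|k0|->] := ltrgt0P k.
- have -> : 1 + sc k * p = sc k * (sc k^-1 + p).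
    by nc_ring A [:: p] (@nil nc_spec); field; rewrite ?gt_eqF.
  apply: invertibleM; first by apply: invertible_sc; rewrite gt_eqF.
  by apply: pp.2; rewrite invr_gt0.
- have -> : 1 + sc k * p = sc (- k) * (sc (- k^-1 - t) + (sc t - p)).
    by nc_ring A [:: p] (@nil nc_spec); field; rewrite ?lt_eqF.
  apply: invertibleM; first by apply: invertible_sc; rewrite oppr_eq0 lt_eqF.
  apply: pt.2; rewrite subr_gt0 -invrN -[ltLHS]invrK.
  rewrite ltf_pV2 ?posrE ?oppr_gt0 ?invr_gt0 //.
  by rewrite /k; lra.
- by rewrite rmorph0 mul0r addr0; exists 1; split; rewrite mulr1.
Qed.

Lemma pos_inv p p' : pos p -> is_inverse p p' -> pos p'.
Proof.
move=> pp pp'; have n0 := nrm_ge0 A p; have t0 : 0 < nrm p + 1 by lra.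
apply: (spos_pos (c := (nrm p + 1)^-1)); first by rewrite invr_ge0 ltW.
by apply: pos_inverse pp' t0 _ => //; apply: pos_sub; [exact: pp.1 | lra].
Qed.

(* If [p] is invertible then [1 + p * q = p * (p^-1 + q)] is invertible for
   every positive [q]; by Jacobson's lemma so is [1 + y * p * y], [q = y * y]. *)
Lemma spos_conj p y c : 0 < c -> pos (p - sc c) -> sa y -> pos (y * p * y).
Proof.
move=> c0 pc sy; have pp := spos_pos (ltW c0) pc.
have [p' pp'] := spos_invertible c0 pc.
have n0 := nrm_ge0 A p; pose t := nrm p + 1; have t0 : 0 < t by rewrite /t; lra.
have pt' : pos (p' - sc t^-1).
  by apply: pos_inverse pp' t0 _ => //; apply: pos_sub; [exact: pp.1 | rewrite /t; lra].
have [pp1 p'p1] := pp'; split=> [|e e0]; first by apply: sa_conj => //; exact: pp.1.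
have -> : sc e + y * p * y = sc e * (1 + y * (sc e^-1 * p * y)).
  by nc_ring A [:: y; p] (@nil nc_spec); field; rewrite ?gt_eqF.
apply: invertibleM; first by apply: invertible_sc; rewrite gt_eqF.
apply: invertible_1addC.
(* The lower bound [t^-1] of [p'] leaves the scalar [e / t], which makes the last factor
   invertible. *)
have -> : 1 + sc e^-1 * p * y * y
    = sc e^-1 * p * (sc (e / t) + (sc e * (p' - sc t^-1) + y * y)).
  by nc_ring A [:: y; p; p'] [:: NcInv 1 2]%N; field; rewrite ?gt_eqF.
apply: invertibleM.
  by apply: invertibleM; [apply: invertible_sc; rewrite invr_eq0 gt_eqF | exists p'].
apply: (posD _ (pos_sqr sy)).2; last exact: divr_gt0.
by apply: pos_scM => //; exact: ltW.
Qed.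

Lemma pos_conj x y : pos x -> sa y -> pos (y * x * y).
Proof.
move=> px sy; apply: (@pos_limit_bound _ (y * y)).
- by apply: sa_conj => //; exact: px.1.
- exact: sa_sqr.
move=> e e0; have -> : y * x * y + sc e * (y * y) = y * (x + sc e) * y.
  by nc_ring A [:: y; x] (@nil nc_spec); ring.
by apply: (@spos_conj _ _ e); rewrite ?addrK.
Qed.

(** A square root [s] of [x + e] commutes with [y], so [(x + e) * y = s * y * s]; then [e] tends to
    0. *)
Lemma pos_commM x y : pos x -> pos y -> x * y = y * x -> pos (x * y).
Proof.
move=> px py xy; have sxy : sa (x * y) := sa_commM px.1 py.1 xy.
apply: (@pos_limit_bound _ y) => [//||e e0]; first exact: py.1.
have [|s [ps s2 sC]] := @pos_sqrt (x + sc e) e e0; first by rewrite addrK.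
have ys : y * s = s * y.
  by apply: sC; nc_ring A [:: x; y] [:: NcCom 0 1]%N; ring.
have -> : x * y + sc e * y = s * y * s.
  by rewrite -mulrDl -s2 -!mulrA ys.
by apply: pos_conj => //; exact: ps.1.
Qed.

(* Lyapunov: [y * (t + x)] has strictly positive real part [h], hence is
   [s * (1 + im * q) * s] with [s * s = h] and [q] self-adjoint. *)
Lemma lyapunov y x c : 0 < c -> pos (y - sc c) -> sa x ->
  pos (y * x + x * y) -> pos x.
Proof.
move=> c0 yc sx yx; split=> // t t0.
have sy : sa y := (spos_pos (ltW c0) yc).1.
have [y' [yy' y'y]] := spos_invertible c0 yc.
pose h := sc 2^-1 * (y * x + x * y) + sc t * y.
pose q := sc (- 2^-1) * (im * (y * x - x * y)).
have sq : sa q by apply: sa_scM; exact: sa_lie.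
have tc : 0 < t * c by exact: mulr_gt0.
have ph : pos (h - sc (t * c)).
  have -> : h - sc (t * c) = sc 2^-1 * (y * x + x * y) + sc t * (y - sc c).
    by rewrite /h; nc_ring A [:: y; x] (@nil nc_spec); ring.
  by apply: posD; apply: pos_scM => //; lra.
have [s [ps s2 _]] := pos_sqrt tc ph.
have [s' ss'] : invertible s.
  by apply: (@invertible_commM _ s s) => //; rewrite s2; exact: spos_invertible ph.
have [s1 s'1] := ss'.
have sq' : sa (s' * q * s') by apply: sa_conj => //; apply: sa_inv ss'; exact: ps.1.
have -> : sc t + x = y' * (s * (im * (s' * q * s' + im * sc (- 1))) * s).
  transitivity (y' * (h + im * q)).
    by rewrite /h /q; nc_ring A [:: im; y; y'; x]
      [:: NcImag 0; NcCom 0 1; NcCom 0 2; NcCom 0 3; NcInv 1 2]%N; field.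
  congr (_ * _); rewrite -s2.
  by nc_ring A [:: im; s; s'; q] [:: NcImag 0; NcCom 0 1; NcCom 0 2; NcCom 0 3;
    NcInv 1 2]%N; ring.
apply: invertibleM; first by exists y.
apply: invertibleM; last by exists s'.
apply: invertibleM; first by exists s'.
apply: invertibleM; last by apply: invertible_addim; rewrite ?oppr_eq0 ?oner_eq0.
by exists (- im); split; rewrite ?mulrN ?mulNr imM opprK.
Qed.

End Positive.

(** * Squares, inverses and the geometric mean *)

Section GeometricMean.
Variables (R : realType) (T : pzRingType) (A : opalg R T).
Local Notation sc := (sc A).
Local Notation im := (im A).
Local Notation nrm := (nrm A).
Local Notation sa := (sa A).
Local Notation pos := (pos A).
Implicit Types (a b c r t : R) (x y z d s p q : T).

Lemma sqr_le_sqr_normalized x y y' c : 0 < c -> pos x -> pos (y - sc c) ->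
  is_inverse y y' -> pos (sc 2 - (x + y')) -> pos (y * y - x * x).
Proof.
move=> c0 px yc yy' pxy; have py := spos_pos (ltW c0) yc.
have py' := pos_inv py yy'; have [yy1 y'y1] := yy'.
have [sx sy sy'] : [/\ sa x, sa y & sa y'] by split; [case: px | case: py | case: py'].
apply: (lyapunov c0 yc); first by apply: saB; exact: sa_sqr.
pose u := x + y; pose v := y - x.
have su : sa u by exact: saD.
have -> : y * (y * y - x * x) + (y * y - x * x) * y =
    sc 2^-1 * (v * (x + y') * v + sc 2 * (u * (sc 2 - (x + y')) * u)
      + ((sc 2 - u) * x * (sc 2 - u)
         + (sc 2 * (y * y) - u) * y' * (sc 2 * (y * y) - u))).
  by rewrite /u /v; nc_ring A [:: x; y; y'] [:: NcInv 1 2]%N; field.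
apply: pos_scM; first by rewrite invr_ge0.
apply: posD; apply: posD.
- by apply: pos_conj; [exact: posD | exact: saB].
- by apply: pos_scM => //; apply: pos_conj.
- by apply: pos_conj => //; apply: saB => //; exact: sa_sc.
- by apply: pos_conj => //; apply: saB => //; apply: sa_scM; exact: sa_sqr.
Qed.

Lemma sqr_le_sqr x y y' c k t : 0 < c -> 0 < k -> 0 < t ->
  pos x -> pos (y - sc c) -> is_inverse y y' ->
  pos (sc t - (x + sc k * y')) ->
  pos (sc ((t ^+ 2 / (4 * k)) ^+ 2) * (y * y) - x * x).
Proof.
move=> c0 k0 t0 px yc yy' pxy.
have k1 : k != 0 by rewrite gt_eqF.
have t1 : t != 0 by rewrite gt_eqF.
(* Passing to [(2 / t) * x] and [l * y] normalizes the bound to 2: [(2 / t) * k = l^-1], while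
   [(t / 2) * l = t ^ 2 / (4 * k)] is the constant sought. *)
pose l := t / (2 * k); have l0 : 0 < l by rewrite divr_gt0 // mulr_gt0.
have -> : sc ((t ^+ 2 / (4 * k)) ^+ 2) * (y * y) - x * x
    = sc ((t / 2) ^+ 2) * (sc l * y * (sc l * y) - sc (2 / t) * x * (sc (2 / t) * x)).
  by rewrite /l; nc_ring A [:: x; y] (@nil nc_spec); field; rewrite ?k1 ?t1.
apply: pos_scM; first exact: sqr_ge0.
apply: (@sqr_le_sqr_normalized _ _ (sc l^-1 * y') (l * c)).
- exact: mulr_gt0.
- by apply: pos_scM => //; rewrite ltW // divr_gt0.
- by rewrite rmorphM -mulrBr; apply: pos_scM => //; exact: ltW.
- rewrite -(scC A l^-1 y'); apply: is_inverseM => //.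
  by apply: is_inverse_sc; rewrite gt_eqF.
- have -> : sc 2 - (sc (2 / t) * x + sc l^-1 * y')
      = sc (2 / t) * (sc t - (x + sc k * y')).
    by rewrite /l; nc_ring A [:: x; y'] (@nil nc_spec); field; rewrite ?k1 ?t1.
  by apply: pos_scM => //; rewrite ltW // divr_gt0.
Qed.

(** The difference is [(b - x) * (x - a) * x^-1], a product of commuting positive elements. *)
Lemma add_inverse_le x x' a b : 0 < a -> pos (x - sc a) -> pos (sc b - x) ->
  is_inverse x x' -> pos (sc (b + a) - (x + sc (b * a) * x')).
Proof.
move=> a0 xa bx xx'; have [xx1 x'x1] := xx'.
have px := spos_pos (ltW a0) xa; have px' := pos_inv px xx'.
have -> : sc (b + a) - (x + sc (b * a) * x') = (sc b - x) * ((x - sc a) * x').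
  by nc_ring A [:: x; x'] [:: NcInv 0 1]%N; ring.
apply: pos_commM => //; first by apply: pos_commM => //;
  nc_ring A [:: x; x'] [:: NcInv 0 1]%N; ring.
by nc_ring A [:: x; x'] [:: NcInv 0 1]%N; ring.
Qed.

Variable P : set T.
Hypothesis PE : forall x, P x <-> pos x.

Lemma psqrtP p c : 0 < c -> pos (p - sc c) ->
  pos (psqrt P p) /\ psqrt P p * psqrt P p = p.
Proof.
move=> c0 pc; have [s [ps s2 _]] := pos_sqrt c0 pc.
have : exists x, [set x | P x /\ x ^+ 2 = p]%classic x.
  by exists s; split; [exact/PE | rewrite expr2].
by move/(xgetPex 0) => [/PE ps2 /=]; rewrite expr2.
Qed.

Lemma rinvP x : invertible x -> is_inverse x (rinv x).
Proof. by move/(xgetPex x). Qed.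

(** With [s ^ 2 = x] and [t ^ 2 = s^-1 * y * s^-1], the mean is [s * t * s], and conjugation by [s]
    reduces the claim to [1 + t^-2 >= 2 * r * t^-1]. The gap [x <= b <= c <= y] forces
    [t >= l = sqrt (c / b)], where this holds. *)
Lemma gmean_inverse_le x y x' y' a b c r :
    0 < a -> 0 < b -> b <= c ->
    r <= (Num.sqrt (c / b) + (Num.sqrt (c / b))^-1) / 2 ->
    pos (x - sc a) -> pos (sc b - x) -> pos (y - sc c) ->
    is_inverse x x' -> is_inverse y y' ->
  exists g' (d : R), [/\ is_inverse (gmean P x y) g', 0 < d,
    pos (gmean P x y - sc d) & pos (x' + y' - sc (2 * r) * g')].
Proof.
move=> a0 b0 bc rr xa bx yc xx' yy'; have c0 : 0 < c by exact: lt_le_trans bc.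
have [ps s2] := psqrtP a0 xa.
rewrite /gmean; set s := psqrt P x in ps s2 *.
have invs : invertible s.
  by apply: (@invertible_commM _ s s) => //; rewrite s2; exists x'.
have ss' := rinvP invs; set s' := rinv s in ss' *; have [s1 s'1] := ss'.
have ps' := pos_inv ps ss'.
have s's' : s' * s' = x'.
  by have := is_inverseM ss' ss'; rewrite s2 => /is_inverse_uniq; apply.
set k := c / b in rr; set l := Num.sqrt k in rr.
have k0 : 1 <= k by rewrite /k ler_pdivlMr // mul1r.
have ll : l * l = k by rewrite -expr2 sqr_sqrtr //; lra.
have l1 : 1 <= l by rewrite -sqrtr1 ler_wsqrtr.
have l0 : 0 < l by lra.
(* From [y >= c] and [x^-1 >= b^-1]. *)
have pz : pos (s' * y * s' - sc k).
  have -> : s' * y * s' - sc k = s' * (y - sc c) * s' + sc c * (x' - sc b^-1).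
    by rewrite -s's' /k; nc_ring A [:: s'; y] (@nil nc_spec); ring.
  apply: posD; first by apply: pos_conj => //; case: ps'.
  apply: pos_scM; first exact: ltW.
  by apply: (pos_inverse _ xx') => //; exact: spos_pos (ltW a0) xa.
have k00 : 0 < k by lra.
have [pt t2] := psqrtP k00 pz; set t := psqrt P (s' * y * s') in pt t2 *.
have invt : invertible t.
  by apply: (@invertible_commM _ t t) => //; rewrite t2; exact: spos_invertible pz.
have [t' tt'] := invt; have [t1 t'1] := tt'; have pt' := pos_inv pt tt'.
(* Lyapunov's theorem takes the square root of [t ^ 2 >= l ^ 2]. *)
have ptl : pos (t - sc l).
  apply: (@lyapunov _ _ A (t + sc l) _ l l0); first by rewrite addrK.
    by apply: saB; [case: pt | exact: sa_sc].
  have -> : (t + sc l) * (t - sc l) + (t - sc l) * (t + sc l)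
      = sc 2 * (s' * y * s' - sc k).
    by rewrite -t2 -ll; nc_ring A [:: t] (@nil nc_spec); ring.
  exact: pos_scM.
exists (s' * (t' * s')), (l * a); split.
- by do 2?apply: is_inverseM.
- exact: mulr_gt0.
- have -> : s * t * s - sc (l * a) = s * (t - sc l) * s + sc l * (x - sc a).
    by rewrite -s2; nc_ring A [:: s; t] (@nil nc_spec); ring.
  apply: posD; first by apply: pos_conj => //; case: ps.
  by apply: pos_scM => //; exact: ltW.
have y'E : y' = s' * (t' * t') * s'.
  apply: (is_inverse_uniq yy').
  have -> : y = s * (t * t) * s.
    by rewrite t2; nc_ring A [:: s; s'; y] [:: NcInv 0 1]%N; ring.
  by split; nc_ring A [:: s; s'; t; t'] [:: NcInv 0 1; NcInv 2 3]%N; ring.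
(* [(1 - l * t') * (1 - t' / l) = 1 - (l + l^-1) * t' + t' ^ 2]; both factors are positive because
   [t' <= l^-1] and [l >= 1]. *)
pose w := 1 - sc l * t'.
have pw : pos w.
  have -> : w = t' * (t - sc l).
    by rewrite /w; nc_ring A [:: t; t'] [:: NcInv 0 1]%N; ring.
  by apply: pos_commM => //; nc_ring A [:: t; t'] [:: NcInv 0 1]%N; ring.
have pw' : pos (1 - sc l^-1 * t').
  have -> : 1 - sc l^-1 * t' = sc (1 - l^-1 * l^-1) + sc (l^-1 * l^-1) * w.
    by rewrite /w; nc_ring A [:: t'] (@nil nc_spec); field; rewrite gt_eqF.
  apply: posD; last by apply: pos_scM => //; rewrite -expr2 sqr_ge0.
  apply: pos_sc; rewrite subr_ge0 -invfM invf_le1 ?mulr_gt0 //; nra.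
have -> : x' + y' - sc (2 * r) * (s' * (t' * s')) =
   s' * (w * (1 - sc l^-1 * t') + sc (l + l^-1 - 2 * r) * t') * s'.
  rewrite y'E -s's' /w.
  by nc_ring A [:: s'; t'] (@nil nc_spec); field; rewrite ?gt_eqF.
apply: pos_conj; last by case: ps'.
apply: posD.
  by apply: pos_commM => //; rewrite /w; nc_ring A [:: t'] (@nil nc_spec); ring.
by apply: pos_scM => //; lra.
Qed.

End GeometricMean.

(** * A lower bound for the hyperbolic cosine *)

Section ScalarInequality.
Variable R : realType.
Implicit Types x q : R.

Lemma ler_sinh x : 0 <= x -> 2 * x <= expR x - expR (- x).
Proof.
move=> x0; pose f y : R := expR y - expR (- y) - 2 * y.
have fd (y : R) : is_derive y (1 : R) f (expR y + expR (- y) - 2).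
  apply: is_derive_eq.
  by rewrite /GRing.scale /= mulrN1 opprK mulr1.
have [|y _] := @MVT_segment R f _ 0 x x0 (fun y _ => fd y).
  apply: continuous_subspaceT => y; apply/differentiable_continuous/derivable1_diffP.
  by have [] := fd y.
rewrite /f oppr0 expR0 subrr mulr0 !subr0 => e.
suff : 0 <= expR y + expR (- y) - 2 by nra.
have e1 : expR y * expR (- y) = 1 by rewrite -expRD subrr expR0.
have := sqr_ge0 (expR y - expR (- y)); have := expR_gt0 y; have := expR_gt0 (- y).
nra.
Qed.

(** For [x = ln q / 4] the right-hand side is [cosh (2 x) = 1 + 2 (sinh x) ^ 2], at least
    [1 + 2 x ^ 2]. *)
Lemma ler_sqrt_mean q : 1 <= q ->
  1 + ln q ^+ 2 / 8 <= (Num.sqrt q + (Num.sqrt q)^-1) / 2.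
Proof.
move=> q1; have q0 : 0 < q by lra.
pose x := ln q / 4; have x0 : 0 <= x by rewrite divr_ge0 ?ln_ge0.
have sq : Num.sqrt q = expR x ^+ 2.
  apply/eqP; rewrite -(eqrXn2 (ltn0Sn 1)) ?sqrtr_ge0 ?sqr_ge0 //.
  rewrite sqr_sqrtr ?(ltW q0) // -!expRM_natl -{1}[q]lnK ?posrE //.
  by apply/eqP; congr expR; rewrite /x; field.
have e1 : expR x * expR (- x) = 1 by rewrite -expRD subrr expR0.
have -> : (Num.sqrt q)^-1 = expR (- x) ^+ 2.
  by rewrite sq expRN exprVn.
have := ler_sinh x0; have -> : ln q = 4 * x by rewrite /x; field.
rewrite sq; nra.
Qed.

End ScalarInequality.

(** * Positive unital maps *)

Section PositiveMaps.
Variables (R : realType) (T U : pzRingType) (A : opalg R T) (B : opalg R U).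
Variable Phi : T -> U.
Hypothesis PhiD : {morph Phi : x y / x + y}.
Hypothesis PhiZ : forall c x, Phi (sc A c * x) = sc B c * Phi x.
Hypothesis Phi1 : Phi 1 = 1.
Hypothesis Phi_pos : forall x, pos A x -> pos B (Phi x).

Lemma PhiB x y : Phi (x - y) = Phi x - Phi y.
Proof.
by rewrite PhiD -[- y]mulN1r -(rmorphN1 (sc A)) PhiZ rmorphN1 mulN1r.
Qed.

Lemma Phi_sc c : Phi (sc A c) = sc B c.
Proof. by rewrite -[sc A c]mulr1 PhiZ Phi1 mulr1. Qed.

(* With [w_i = Phi (x ^ i * w)] and [0 <= x <= 1], this is the value at
   [p(x) = a + b * x] of the would-be square
   [Phi ((p(x) - y) * w * (p(x) - y))], in which [y] is outside of the domain
   of [Phi], plus an error term [e * b ^ 2 * Phi (x * (1 - x) * w)]. *)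
Let quad (y : U) (e a b : R) (w0 w1 w2 : U) :=
  sc B (a ^+ 2) * w0 + sc B (2 * a * b) * w1 + sc B (b ^+ 2) * w2
  - y * (sc B a * w0 + sc B b * w1) - (sc B a * w0 + sc B b * w1) * y
  + y * w0 * y + sc B (b ^+ 2 * e) * (w1 - w2).

(* Replacing [w] by [x * w + (1 - x) * w], the two terms are treated with
   [t * x + (1 - t)] and [t * x] in place of [x]; the average of these two
   values for the weights [x] and [1 - x] is [x]. *)
Lemma quad_pos (y : U) (x : T) n : sa B y -> pos A x -> pos A (1 - x) ->
  forall w a b, pos A w -> x * w = w * x ->
  pos B (quad y n.+1%:R^-1 a b (Phi w) (Phi (x * w)) (Phi (x * (x * w)))).
Proof.
move=> sy px px1; elim: n => [|n IH] w a b pw xw.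
  (* With error coefficient 1, the square of [p] is interpolated between the ends of the interval:
     weight [1 - x] on [a ^ 2] and [x] on [(a + b) ^ 2]. *)
  rewrite invr1.
  have -> : quad y 1 a b (Phi w) (Phi (x * w)) (Phi (x * (x * w))) =
      (sc B a - y) * Phi ((1 - x) * w) * (sc B a - y)
      + (sc B (a + b) - y) * Phi (x * w) * (sc B (a + b) - y).
    have -> : (1 - x) * w = w - x * w by rewrite mulrBl mul1r.
    rewrite /quad PhiB.
    move: (Phi w) (Phi (x * w)) (Phi (x * (x * w))) => w0 w1 w2.
    by nc_ring B [:: y; w0; w1; w2] (@nil nc_spec); ring.
  apply: posD; apply: pos_conj.
  - apply: Phi_pos; apply: pos_commM => //.
    by rewrite mulrBl mulrBr xw mul1r mulr1.
  - by apply: saB => //; exact: sa_sc.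
  - by apply: Phi_pos; apply: pos_commM.
  - by apply: saB => //; exact: sa_sc.
set e := n.+1%:R^-1 in IH; set e' := n.+2%:R^-1.
have n0 : (0 : R) < n.+1%:R by rewrite ltr0n.
have n1 : (n.+2%:R : R) = n.+1%:R + 1 by rewrite -natr1.
(* Chosen so that the error coefficient drops from [1 / (n + 1)] to [1 / (n + 2)]: this is [te]. *)
pose t : R := n.+1%:R / n.+2%:R.
have te : (1 - t) ^+ 2 + t ^+ 2 * e = e'.
  by rewrite /t /e /e' n1; field; rewrite ?gt_eqF //; lra.
have -> : quad y e' a b (Phi w) (Phi (x * w)) (Phi (x * (x * w))) =
    quad y e (a + b * (1 - t)) (b * t)
      (Phi (x * w)) (Phi (x * (x * w))) (Phi (x * (x * (x * w))))
    + quad y e a (b * t) (Phi ((1 - x) * w)) (Phi (x * ((1 - x) * w)))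
      (Phi (x * (x * ((1 - x) * w)))).
  have -> : (1 - x) * w = w - x * w by rewrite mulrBl mul1r.
  rewrite /quad -te !(mulrBr x) !PhiB.
  move: (Phi w) (Phi (x * w)) (Phi (x * (x * w))) (Phi (x * (x * (x * w)))).
  move=> w0 w1 w2 w3.
  by nc_ring B [:: y; w0; w1; w2; w3] (@nil nc_spec); ring.
apply: posD; apply: IH.
- exact: pos_commM.
- by rewrite -mulrA -xw.
- by apply: pos_commM => //; rewrite mulrBl mulrBr xw mul1r mulr1.
- by rewrite !mulrBl mulrBr mul1r -mulrA -xw.
Qed.

(** [quad_pos] is used with [w = g], [x = c * g^-1] and [p(x) = x / c = g^-1]. The square expands to
    [Phi g' - y' - y' + y' * Phi g * y' = Phi g' - y'], and the error is [z / (n + 1)], which tends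
    to 0. *)
Lemma choi_inverse g g' y' c : 0 < c -> pos A (g - sc A c) ->
  is_inverse g g' -> is_inverse (Phi g) y' -> pos B (Phi g' - y').
Proof.
move=> c0 gc gg' yy'; have pg := spos_pos (ltW c0) gc.
have pg' := pos_inv pg gg'; have [gg1 g'g1] := gg'; have [yy1 y'y1] := yy'.
have py' := pos_inv (Phi_pos pg) yy'; have sy' : sa B y' by case: py'.
pose x := sc A c * g'.
have px : pos A x by apply: pos_scM => //; exact: ltW.
have px1 : pos A (1 - x).
  have -> : 1 - x = g' * (g - sc A c).
    by rewrite /x; nc_ring A [:: g; g'] [:: NcInv 0 1]%N; ring.
  by apply: pos_commM => //; nc_ring A [:: g; g'] [:: NcInv 0 1]%N; ring.
have xg : x * g = sc A c by rewrite /x -mulrA g'g1 mulr1.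
have gx : g * x = sc A c by rewrite /x -scC mulrA gg1 mul1r.
have xxg : x * (x * g) = sc A (c ^+ 2) * g'.
  by rewrite xg /x; nc_ring A [:: g'] (@nil nc_spec); ring.
pose z := sc B (c ^- 2) * (Phi (x * g) - Phi (x * (x * g))).
have pz : pos B z.
  apply: pos_scM; first by rewrite invr_ge0 sqr_ge0.
  rewrite -PhiB; apply: Phi_pos.
  have -> : x * g - x * (x * g) = x * ((1 - x) * g) by rewrite mulrBl mul1r mulrBr.
  have c1 : (1 - x) * g = g * (1 - x) by rewrite mulrBl mulrBr xg gx mul1r mulr1.
  apply: pos_commM => //; first exact: pos_commM.
  by rewrite mulrBl mul1r mulrBr mulrBl xg gx -!scC.
apply: (@pos_limit_bound _ _ B _ z).
- by apply: saB => //; case: (Phi_pos pg').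
- by case: pz.
move=> e e0; have [n ne] : exists n, n.+1%:R^-1 < e.
  exists (Num.truncn e^-1); rewrite invf_plt ?posrE ?ltr0n //.
  by rewrite truncnS_gt.
have -> : Phi g' - y' + sc B e * z = quad y' n.+1%:R^-1 0 c^-1
    (Phi g) (Phi (x * g)) (Phi (x * (x * g))) + sc B (e - n.+1%:R^-1) * z.
  rewrite /quad /z xxg xg PhiZ Phi_sc.
  move: (n.+1%:R^-1 : R) => k; move: (Phi g) (Phi g') yy1 y'y1 => w w' yy1 y'y1.
  by nc_ring B [:: y'; w; w'] [:: NcInv 0 1]%N; field; rewrite ?gt_eqF.
apply: posD; first by apply: quad_pos => //; rewrite xg gx.
by apply: pos_scM => //; rewrite subr_ge0 ltW.
Qed.

Variables (P : set T) (Q : set U).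
Hypothesis PE : forall x, P x <-> pos A x.
Hypothesis QE : forall x, Q x <-> pos B x.

Lemma sqr_mean_le_sqr_gmean (a b : T) (m m' M' M : R) :
  0 < m -> 0 < m' -> m' <= M' -> 0 < M ->
  pos A (a - sc A m) -> pos A (sc A m' - a) ->
  pos A (b - sc A M') -> pos A (sc A M - b) ->
  pos A (b - sc A m) -> pos A (sc A M - a) ->
  let c := kantorovich (M / m) ^+ 2 / (1 + ln (M' / m') ^+ 2 / 8) ^+ 2 in
  let x := Phi (sc A 2^-1 * (a + b)) in
  let g := Phi (gmean P a b) in
  let g' := gmean Q (Phi a) (Phi b) in
  pos B (sc B c * (g * g) - x * x) /\ pos B (sc B c * (g' * g') - x * x).
Proof.
move=> m0 m'0 mM' M0 am m'a bM' Mb bm Ma.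
set r := 1 + ln (M' / m') ^+ 2 / 8.
have M'0 : 0 < M' by lra.
have r0 : 0 < r by have := sqr_ge0 (ln (M' / m')); rewrite /r; lra.
have rr : r <= (Num.sqrt (M' / m') + (Num.sqrt (M' / m'))^-1) / 2.
  by apply: ler_sqrt_mean; rewrite ler_pdivlMr // mul1r.
have [a' aa'] := spos_invertible m0 am.
have [b' bb'] := spos_invertible M'0 bM'.
have la := add_inverse_le m0 am Ma aa'.
have lb := add_inverse_le m0 bm Mb bb'.
have [g' [d [gg' d0 pg lg]]] := gmean_inverse_le PE m0 m'0 mM' rr am m'a bM' aa' bb'.
move=> c x y y2.
have PhiBsc z t : pos A (z - sc A t) -> pos B (Phi z - sc B t).
  by move/Phi_pos; rewrite PhiB Phi_sc.
have Phiscb z t : pos A (sc A t - z) -> pos B (sc B t - Phi z).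
  by move/Phi_pos; rewrite PhiB Phi_sc.
have px : pos B x.
  apply: Phi_pos; apply: pos_scM; first by rewrite invr_ge0.
  by apply: posD; [exact: spos_pos (ltW m0) am | exact: spos_pos (ltW M'0) bM'].
(* With [t = M + m], this [k] turns the constant of [sqr_le_sqr] into [c]. *)
pose k := M * m * r.
have k0 : 0 < k by rewrite !mulr_gt0.
have cE : c = ((M + m) ^+ 2 / (4 * k)) ^+ 2.
  rewrite /c /kantorovich -/r /k; field.
  by rewrite ?gt_eqF //; lra.
have Mm0 : 0 < M + m by lra.
(* The average of the images under [Phi] of the bounds [la] and [lb]. *)
have lx : pos B (sc B (M + m) - (x + sc B (M * m / 2) * (Phi a' + Phi b'))).
  have := Phi_pos (pos_scM _ (posD la lb)).
  move=> /(_ 2^-1); rewrite invr_ge0 => /(_ (ler0n _ 2)).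
  rewrite PhiZ !(PhiB, PhiD) !PhiZ Phi_sc => h.
  apply: (eq_ind _ (pos B) h); rewrite /x PhiZ PhiD.
  move: (Phi a) (Phi b) (Phi a') (Phi b') => w1 w2 w3 w4.
  by nc_ring B [:: w1; w2; w3; w4] (@nil nc_spec); field.
(* Common end of both claims: [z] only has to satisfy [2 * r * z^-1 <= Phi a' + Phi b']. *)
have concl z z' e : 0 < e -> pos B (z - sc B e) -> is_inverse z z' ->
    pos B (Phi a' + Phi b' - sc B (2 * r) * z') ->
    pos B (sc B c * (z * z) - x * x).
  move=> e0 ze zz' lz; rewrite cE; apply: sqr_le_sqr e0 k0 Mm0 px ze zz' _.
  have -> : sc B (M + m) - (x + sc B k * z') =
      sc B (M + m) - (x + sc B (M * m / 2) * (Phi a' + Phi b'))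
      + sc B (M * m / 2) * (Phi a' + Phi b' - sc B (2 * r) * z').
    by rewrite /k; nc_ring B [:: x; Phi a'; Phi b'; z'] (@nil nc_spec); field.
  by apply: posD => //; apply: pos_scM => //; rewrite ltW // divr_gt0 // mulr_gt0.
have pPg := PhiBsc _ _ pg.
have [y' yy'] := spos_invertible d0 pPg.
split.
  (* Here the bound for the mean is used before [Phi], and Choi's inequality for the mean itself. *)
  apply: (concl _ _ _ d0 pPg yy').
  have -> : Phi a' + Phi b' - sc B (2 * r) * y' =
      Phi (a' + b' - sc A (2 * r) * g') + sc B (2 * r) * (Phi g' - y').
    rewrite PhiB PhiD PhiZ; move: (Phi a') (Phi b') (Phi g') => w1 w2 w3.
    by nc_ring B [:: w1; w2; w3; y'] (@nil nc_spec); ring.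
  apply: posD; first exact: Phi_pos.
  apply: pos_scM; first by rewrite mulr_ge0 // ltW.
  exact: choi_inverse d0 pg gg' yy'.
(* Here the bound for the mean is used after [Phi], and Choi's inequality for [a] and [b]
   separately. *)
have pPa := PhiBsc _ _ am; have pPb := PhiBsc _ _ bM'.
have [u' uu'] := spos_invertible m0 pPa.
have [v' vv'] := spos_invertible M'0 pPb.
have [h' [d2 [hh' d20 ph lh]]] :=
  gmean_inverse_le QE m0 m'0 mM' rr pPa (Phiscb _ _ m'a) pPb uu' vv'.
apply: (concl _ _ _ d20 ph hh').
have -> : Phi a' + Phi b' - sc B (2 * r) * h' =
    (Phi a' - u') + (Phi b' - v') + (u' + v' - sc B (2 * r) * h').
  move: (Phi a') (Phi b') => w1 w2.
  by nc_ring B [:: w1; w2; u'; v'; h'] (@nil nc_spec); ring.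
apply: posD => //; apply: posD.
  exact: choi_inverse m0 am aa' uu'.
exact: choi_inverse M'0 bM' bb' vv'.
Qed.

End PositiveMaps.

(** * C*-algebras *)

Lemma geometric_cvg (R : realType) (V : completeNormedModType R[i])
    (y : nat -> V) (C r : R) : 0 <= r < 1 ->
    (forall n, `|y n.+1 - y n| <= (C * r ^+ n)%:C) ->
  exists2 l, y @ \oo --> l &
    forall n, `|l - y n| <= (C / (1 - r) * r ^+ n)%:C.
Proof.
move=> /andP[r0 r1] yC; have r1' : 0 < 1 - r by rewrite subr_gt0.
have C0 : 0 <= C.
  by have := le_trans (normr_ge0 _) (yC 0%N); rewrite expr0 mulr1 lecR.
have K0 : 0 <= C / (1 - r) by rewrite divr_ge0 // ltW.
(* The factor [1 - r ^ k] is the exact geometric partial sum, so the induction closes with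
   equality. *)
have yK n k : `|y (n + k)%N - y n| <= (C / (1 - r) * r ^+ n * (1 - r ^+ k))%:C.
  elim: k => [|k IH].
    by rewrite addn0 subrr normr0 expr0 subrr mulr0.
  rewrite addnS -(subrK (y (n + k)%N) (y _.+1)) -addrA.
  apply: le_trans (ler_normD _ _) _; apply: le_trans (lerD (yC _) IH) _.
  rewrite -rmorphD lecR le_eqVlt; apply/orP; left; apply/eqP.
  by rewrite exprD exprS; field; rewrite gt_eqF.
have yB n k : (n <= k)%N -> `|y k - y n| <= (C / (1 - r) * r ^+ n)%:C.
  move=> nk; rewrite -(subnKC nk); apply: le_trans (yK _ _) _.
  rewrite lecR ler_piMr //; first by apply: mulr_ge0 => //; exact: exprn_ge0.
  by rewrite lerBlDr lerDl exprn_ge0.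
have rn (e : R) : 0 < e -> exists n, C / (1 - r) * r ^+ n < e.
  move=> e0.
  have : (fun n => C / (1 - r) * r ^+ n) @ \oo --> (0 : R).
    rewrite -[X in _ --> X](mulr0 (C / (1 - r))).
    by apply: cvgMr; apply: cvg_expr; rewrite ger0_norm.
  move/cvgrPdist_lt => /(_ e e0)[n _ /(_ n (leqnn n))] /=.
  by rewrite sub0r normrN => ?; exists n; apply: le_lt_trans (ler_norm _) _.
have yc : cvg (y @ \oo).
  apply/cauchy_cvgP/cauchy_exP => e e0.
  have eE : e = (complex.Re e)%:C by rewrite RRe_real // gtr0_real.
  have [|n ne] := rn (complex.Re e); first by rewrite -ltcR -eE.
  exists (y n); exists n => // k /= nk; rewrite -ball_normE /=.
  by rewrite distrC eE; apply: le_lt_trans (yB _ _ nk) _; rewrite ltcR.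
exists (lim (y @ \oo)) => // n; apply/ler_addgt0Pr => e e0.
move/cvgrPdist_lt : yc => /(_ e e0)[N _ yN].
apply: le_trans (ler_distD (y (maxn n N)) _ _) _; rewrite [leRHS]addrC lerD //.
  by apply/ltW/yN; exact: leq_maxr.
by apply: yB; exact: leq_maxl.
Qed.

Section Cstar.
Variables (R : realType) (U : cstarAlgType R).
Implicit Types x y z : U.

Lemma cstar_scalel (c : R[i]) x y : (c *: x) * y = c *: (x * y).
Proof. exact: cmulZl. Qed.

Lemma cstar_scaler (c : R[i]) x y : x * (c *: y) = c *: (x * y).
Proof. exact: cmulZr. Qed.

Lemma cstar_normM x y : `|x * y| <= `|x| * `|y|.
Proof. exact: cmul_norm. Qed.

Lemma starD x y : star (x + y) = star x + star y.
Proof. by rewrite -[x]scale1r starDZ conjC1 !scale1r. Qed.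

Lemma starZ (c : R[i]) x : star (c *: x) = Num.conj c *: star x.
Proof.
have star0 : star (0 : U) = 0.
  by apply: (addrI (star (0 : U))); rewrite -starD !addr0.
by rewrite -[c *: x]addr0 starDZ star0 addr0.
Qed.

Lemma starN x : star (- x) = - star x.
Proof. by rewrite -scaleN1r starZ rmorphN1 scaleN1r. Qed.

Lemma star_mul x y : star (x * y) = star y * star x.
Proof. exact: starM. Qed.

Lemma star1 : star (1 : U) = 1.
Proof. by rewrite -[LHS]mulr1 -[X in _ * X]starK -star_mul mulr1 starK. Qed.

Definition cstar_sc (c : R) : U := c%:C *: (1 : U).

Fact cstar_sc_additive : zmod_morphism cstar_sc.
Proof. by move=> a b; rewrite /cstar_sc rmorphB scalerBl. Qed.

Fact cstar_sc_monoid : monoid_morphism cstar_sc.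
Proof.
split; first by rewrite /cstar_sc scale1r.
by move=> a b; rewrite /cstar_sc cstar_scalel mul1r scalerA rmorphM.
Qed.

HB.instance Definition _ := GRing.isZmodMorphism.Build R U cstar_sc cstar_sc_additive.
HB.instance Definition _ := GRing.isMonoidMorphism.Build R U cstar_sc cstar_sc_monoid.

Definition cstar_nrm x : R := complex.Re `|x|.

Lemma cstar_nrmE x : (cstar_nrm x)%:C = `|x|.
Proof. exact/RRe_real/normr_real. Qed.

Lemma cstar_scM (c : R) x : cstar_sc c * x = c%:C *: x.
Proof. by rewrite /cstar_sc cstar_scalel mul1r. Qed.

Lemma cstar_imM x : ('i *: (1 : U)) * x = 'i *: x.
Proof. by rewrite cstar_scalel mul1r. Qed.

Fact cstar_scC (c : R) x : x * cstar_sc c = cstar_sc c * x.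
Proof. by rewrite cstar_scM /cstar_sc cstar_scaler mulr1. Qed.

Fact cstar_imC x : x * ('i *: (1 : U)) = ('i *: (1 : U)) * x.
Proof. by rewrite cstar_imM cstar_scaler mulr1. Qed.

Fact cstar_imMim : ('i *: (1 : U)) * ('i *: (1 : U)) = - 1.
Proof. by rewrite cstar_imM scalerA -expr2 sqr_i scaleN1r. Qed.

Fact cstar_nrm_ge0 x : 0 <= cstar_nrm x.
Proof. by rewrite -lecR cstar_nrmE; exact: normr_ge0. Qed.

Fact cstar_nrm_eq0 x : cstar_nrm x = 0 -> x = 0.
Proof. by move=> x0; apply/normr0_eq0; rewrite -cstar_nrmE x0. Qed.

Fact cstar_nrmD x y : cstar_nrm (x + y) <= cstar_nrm x + cstar_nrm y.
Proof. by rewrite -lecR rmorphD /= !cstar_nrmE ler_normD. Qed.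

Fact cstar_nrmM x y : cstar_nrm (x * y) <= cstar_nrm x * cstar_nrm y.
Proof. by rewrite -lecR rmorphM /= !cstar_nrmE cstar_normM. Qed.

(** The C*-identity gives [|1| = |1| ^ 2], so [|1|] is 1, or 0 in the zero algebra. *)
Fact cstar_norm1 : `|1 : U| <= 1.
Proof.
have := cstar_norm (1 : U); rewrite -[cmul _ _]/(star 1 * 1) star1 mulr1.
set n := `|(1 : U)|; have n0 : 0 <= n by exact: normr_ge0.
move=> nn; have [->|nz] := eqVneq n 0; first exact: ler01.
by rewrite -[n]mulr1 -{1}(mulfV nz) mulrA -expr2 -nn mulfV.
Qed.

Fact cstar_nrm_scale (c : R[i]) : `|c| <= 1 -> cstar_nrm (c *: (1 : U)) <= 1.
Proof.
move=> c1; rewrite -lecR cstar_nrmE normrZ.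
by rewrite -[leRHS]mulr1; apply: ler_pM => //; exact: cstar_norm1.
Qed.

Fact cstar_nrm_sc (c : R) : cstar_nrm (cstar_sc c) <= `|c|.
Proof.
rewrite -lecR cstar_nrmE normrZ normc_def /= expr0n addr0 sqrtr_sqr.
by rewrite ler_piMr ?lecR ?normr_ge0 // cstar_norm1.
Qed.

Fact cstar_nrm_im : cstar_nrm ('i *: (1 : U)) <= 1.
Proof.
apply: cstar_nrm_scale.
by rewrite normc_def /= expr0n add0r expr1n sqrtr1.
Qed.

Definition cstar_sa x := star x = x.

Fact cstar_conjR (c : R) : Num.conj c%:C = c%:C :> R[i].
Proof. exact: conjc_real. Qed.

Fact cstar_conji : Num.conj 'i = - 'i :> R[i].
Proof. by apply/eqP; rewrite eq_complex /= oppr0 !eqxx. Qed.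

Fact cstar_sa_sc c : cstar_sa (cstar_sc c).
Proof. by rewrite /cstar_sa /cstar_sc starZ star1 cstar_conjR. Qed.

Fact cstar_saD x y : cstar_sa x -> cstar_sa y -> cstar_sa (x + y).
Proof. by rewrite /cstar_sa starD => -> ->. Qed.

Fact cstar_sa_jordan x y : cstar_sa x -> cstar_sa y -> cstar_sa (x * y + y * x).
Proof. by rewrite /cstar_sa starD !star_mul => -> ->; rewrite addrC. Qed.

Fact cstar_sa_lie x y : cstar_sa x -> cstar_sa y ->
  cstar_sa (('i *: (1 : U)) * (x * y - y * x)).
Proof.
rewrite /cstar_sa cstar_imM starZ starD starN !star_mul => -> ->.
by rewrite cstar_conji scaleNr -scalerN opprB.
Qed.

Fact cstar_sa_inv x y : cstar_sa x -> is_inverse x y -> cstar_sa y.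
Proof.
rewrite /cstar_sa => sx xy; apply: (is_inverse_uniq _ xy); case: xy => xy yx.
by split; rewrite -{1}sx -star_mul ?xy ?yx star1.
Qed.

Fact cstar_norm_star x : `|star x| = `|x|.
Proof.
have le y : `|y| <= `|star y|.
  have [->|y0] := eqVneq y 0; first by rewrite normr0.
  rewrite -(ler_pM2r (x := `|y|)) ?normr_gt0 // -expr2 -cstar_norm.
  exact: cstar_normM.
by apply/eqP; rewrite eq_le le /= -{2}[x]starK le.
Qed.

Fact cstar_sa_lim x :
  (forall e : R, 0 < e -> exists y, cstar_sa y /\ cstar_nrm (x - y) <= e) ->
  cstar_sa x.
Proof.
move=> xl; apply/eqP; rewrite -subr_eq0 -normr_le0.
apply/ler_addgt0Pr => e e0; have eE : e = (complex.Re e)%:C.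
  by rewrite RRe_real // gtr0_real.
have [|y [sy xy]] := xl (complex.Re e / 2).
  by rewrite divr_gt0 // -ltcR -eE.
have -> : star x - x = star (x - y) - (x - y).
  by rewrite starD starN sy opprB addrA subrK.
apply: le_trans (ler_normB _ _) _; rewrite cstar_norm_star -cstar_nrmE add0r.
by rewrite -rmorphD eE lecR; lra.
Qed.

(** The C*-identity for [z = x + 'i y]: by commutation [star z * z = x ^ 2 + y ^ 2]. *)
Fact cstar_nrm_normal x y : cstar_sa x -> cstar_sa y -> x * y = y * x ->
  cstar_nrm (x + ('i *: (1 : U)) * y) ^+ 2 <= cstar_nrm (x * x + y * y).
Proof.
rewrite /cstar_sa => sx sy xy; rewrite -lecR rmorphXn /= !cstar_nrmE cstar_imM.
rewrite -cstar_norm -[cmul _ _]/(star _ * _) starD starZ sx sy.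
rewrite mulrDl !mulrDr !cstar_scalel !cstar_scaler scalerA cstar_conji xy.
have ii : 'i * 'i = -1 :> R[i] by rewrite -expr2 sqr_i.
by rewrite mulNr ii opprK scale1r scaleNr addrA addrK.
Qed.

Fact cstar_complete (y : nat -> U) (C r : R) : 0 <= r < 1 ->
    (forall n, cstar_nrm (y n.+1 - y n) <= C * r ^+ n) ->
  exists l, forall e, 0 < e -> exists N, forall n, (N <= n)%N ->
    cstar_nrm (l - y n) <= e.
Proof.
move=> r01 yC; have [|l yl _] := @geometric_cvg R U y C r r01.
  by move=> n; rewrite -cstar_nrmE lecR.
exists l => e e0; move/cvgrPdist_lt : yl => /(_ e%:C)[|N _ yN].
  by rewrite ltcR.
exists N => n Nn; rewrite -lecR cstar_nrmE; apply/ltW; exact: yN.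
Qed.

Definition cstar_opalg : opalg R U :=
  @Opalg R U cstar_sc cstar_scC _ cstar_imC cstar_imMim cstar_nrm
    cstar_nrm_ge0 cstar_nrm_eq0 cstar_nrmD cstar_nrmM cstar_nrm_sc
    cstar_nrm_im cstar_sa cstar_sa_sc cstar_saD cstar_sa_jordan cstar_sa_lie
    cstar_sa_inv cstar_sa_lim cstar_nrm_normal cstar_complete.

(** The spectrum is tested at all complex points on the left and only at negative reals on the
    right; [invertible_addim] handles the non-real ones. *)
Lemma cstar_ge0P x : cstar_ge0 x <-> pos cstar_opalg x.
Proof.
split=> -[sx px]; split=> //.
  move=> t t0; apply: contrapT => ninv.
  have /px : spectrum x (- t%:C).
    move=> [y [xy yx]]; apply: ninv; exists (- y).
    have e : sc cstar_opalg t + x = - (- t%:C *: (1 : U) - x).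
      by rewrite scaleNr opprB opprK addrC.
    by rewrite e; split; rewrite mulrNN.
  by rewrite /= oppr_ge0 lecR; lra.
move=> z zx /=.
have zE : z *: (1 : U) - x = - ((x + sc cstar_opalg (- complex.Re z)) +
    im cstar_opalg * sc cstar_opalg (- complex.Im z)).
  rewrite /= /cstar_sc cstar_imM scalerA !rmorphN /= mulrN !scaleNr opprD.
  by rewrite opprK opprD opprK -addrA -scalerDl addrC -complexE.
have [z0|z0] := eqVneq (complex.Im z) 0; last first.
  exfalso; apply: zx; rewrite zE -[- _]mulN1r; apply: invertibleM.
    by exists (-1); split; rewrite mulrNN mulr1.
  apply: invertible_addim; last by rewrite oppr_eq0.
  by apply: (saD (o:=cstar_opalg)) => //; exact: (sa_sc cstar_opalg).
have zR : z = (complex.Re z)%:C by case: z z0 {zE zx} => a b /= ->.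
rewrite zR lecR leNgt; apply/negP => zneg; apply: zx.
rewrite zE z0 oppr0 rmorph0 mulr0 addr0 -[- _]mulN1r; apply: invertibleM.
  by exists (-1); split; rewrite mulrNN mulr1.
by rewrite addrC; apply: px; rewrite oppr_gt0.
Qed.

End Cstar.

(** * Bounded operators *)

Section HilbertSpace.
Variables (R : realType) (H : hilbertType R).
Implicit Types x y z : H.

Lemma innerDl x y z : inner (x + y) z = inner x z + inner y z.
Proof. by rewrite -[x]scale1r innerDZl mul1r scale1r. Qed.

Lemma inner0l z : inner 0 z = 0 :> R[i].
Proof. by apply: (addrI (inner 0 z)); rewrite -innerDl !addr0. Qed.

Lemma innerZl (a : R[i]) x z : inner (a *: x) z = a * inner x z.
Proof. by rewrite -[a *: x]addr0 innerDZl inner0l addr0. Qed.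

Lemma innerNl x z : inner (- x) z = - inner x z.
Proof. by rewrite -scaleN1r innerZl mulN1r. Qed.

Lemma innerDr x y z : inner z (x + y) = inner z x + inner z y.
Proof. by rewrite innerC innerDl rmorphD /= -!innerC. Qed.

Lemma innerZr (a : R[i]) x z : inner z (a *: x) = Num.conj a * inner z x.
Proof. by rewrite innerC innerZl rmorphM /= -innerC. Qed.

Lemma innerNr x z : inner z (- x) = - inner z x.
Proof. by rewrite innerC innerNl rmorphN /= -innerC. Qed.

(** The squared norm of [|y| *: x - |x| *: y] is [2 |x| |y| (|x| |y| - inner x y)]. *)
Lemma inner_ge0_le x y : 0 <= inner x y -> inner x y <= `|x| * `|y|.
Proof.
move=> xy0; have yx : inner y x = inner x y by rewrite innerC; apply/CrealP/ger0_real.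
have [->|x0] := eqVneq x 0; first by rewrite inner0l normr0 mul0r.
have [->|y0] := eqVneq y 0.
  by rewrite innerC inner0l rmorph0 normr0 mulr0.
have n0 : 0 < `|x| * `|y| by rewrite mulr_gt0 ?normr_gt0.
have cn z : Num.conj `|z| = `|z| by apply/CrealP/normr_real.
have : 0 <= inner (`|y| *: x - `|x| *: y) (`|y| *: x - `|x| *: y).
  by rewrite innerxx exprn_ge0.
rewrite !innerDl !innerDr !innerNl !innerNr !innerZl !innerZr !cn yx !innerxx.
set p := `|x| in n0 *; set q := `|y| in n0 *; set s := inner x y.
rewrite [X in 0 <= X](_ : _ = 2 * (p * q) * (p * q - s)); last by ring.
by rewrite pmulr_rge0 ?subr_ge0 // mulr_gt0.
Qed.

(** Scaling [x] by the conjugate of [inner x y] makes the inner product nonnegative. *)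
Lemma norm_inner_le x y : `|inner x y| <= `|x| * `|y|.
Proof.
have [->|xy0] := eqVneq (inner x y) 0; first by rewrite normr0 mulr_ge0.
have := @inner_ge0_le (Num.conj (inner x y) *: x) y.
rewrite innerZl mulrC -normCK exprn_ge0 // => /(_ isT).
rewrite normrZ norm_conjC expr2 -mulrA ler_pM2l ?normr_gt0 //.
Qed.

End HilbertSpace.

(** * Bounded operators as an operator algebra *)

Section BoundedOperators.
Variables (R : realType) (H : hilbertType R).
Implicit Types (A B C : bop H) (x y z : H) (c : R).

Lemma bopDE A B x : (A + B) x = A x + B x. Proof. by []. Qed.
Lemma bopNE A x : (- A) x = - A x. Proof. by []. Qed.
Lemma bopZE (a : R[i]) A x : (a *: A) x = a *: A x. Proof. by []. Qed.
Lemma bopME A B x : (A * B) x = A (B x). Proof. by []. Qed.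
Lemma bop1E x : (1 : bop H) x = x. Proof. by []. Qed.
Definition bopE := (bopDE, bopNE, bopZE, bopME, bop1E).

Lemma bopD A x y : A (x + y) = A x + A y.
Proof. by have := bop_linear A 1 x y; rewrite !scale1r. Qed.

Lemma bop0 A : A 0 = 0.
Proof. by apply: (addrI (A 0)); rewrite -bopD !addr0. Qed.

Lemma bopZ A (a : R[i]) x : A (a *: x) = a *: A x.
Proof. by have := bop_linear A a x 0; rewrite !addr0 bop0 addr0. Qed.

Lemma bop_scalel (a : R[i]) A B : (a *: A) * B = a *: (A * B).
Proof. exact: bop_eqP. Qed.

Lemma bop_scaler (a : R[i]) A B : A * (a *: B) = a *: (A * B).
Proof. by apply: bop_eqP => x; rewrite !bopE bopZ. Qed.

Definition bop_sc c : bop H := c%:C *: (1 : bop H).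

Fact bop_sc_additive : zmod_morphism bop_sc.
Proof. by move=> a b; rewrite /bop_sc rmorphB scalerBl. Qed.

Fact bop_sc_monoid : monoid_morphism bop_sc.
Proof.
split; first by rewrite /bop_sc scale1r.
by move=> a b; rewrite /bop_sc bop_scalel mul1r scalerA rmorphM.
Qed.

HB.instance Definition _ := GRing.isZmodMorphism.Build R (bop H) bop_sc bop_sc_additive.
HB.instance Definition _ := GRing.isMonoidMorphism.Build R (bop H) bop_sc bop_sc_monoid.

Lemma bop_scM c A : bop_sc c * A = c%:C *: A.
Proof. by rewrite /bop_sc bop_scalel mul1r. Qed.

Definition bop_bound A : set R :=
  [set k | 0 <= k /\ forall x, `|A x| <= k%:C * `|x|].

Definition bop_nrm A : R := inf (bop_bound A).

Lemma bop_bound_has_inf A : has_inf (bop_bound A).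
Proof.
split; last by exists 0 => k [].
have /bounded_opP[_ [k kA]] := bop_valP A.
exists `|k|; split=> // x; apply: le_trans (kA x) _.
by rewrite ler_wpM2r // lecR ler_norm.
Qed.

Lemma bop_nrm_le A k : 0 <= k -> (forall x, `|A x| <= k%:C * `|x|) ->
  bop_nrm A <= k.
Proof. by move=> k0 kA; apply: ge_inf; [case: (bop_bound_has_inf A) | split]. Qed.

Lemma bop_nrm_ge0 A : 0 <= bop_nrm A.
Proof. by apply: lb_le_inf; [case: (bop_bound_has_inf A) | move=> k []]. Qed.

Lemma bop_nrmP A x : `|A x| <= (bop_nrm A)%:C * `|x|.
Proof.
have [->|x0] := eqVneq x 0; first by rewrite bop0 !normr0 mulr0.
have nE z : `|z : H| = (complex.Re `|z|)%:C by rewrite RRe_real // normr_real.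
have x1 : 0 < complex.Re `|x| by rewrite -ltcR -nE normr_gt0.
rewrite (nE x) (nE (A x)) -rmorphM lecR -ler_pdivrMr //.
apply: lb_le_inf; first by case: (bop_bound_has_inf A).
move=> k [_ /(_ x)]; rewrite (nE x) (nE (A x)) -rmorphM lecR.
by rewrite ler_pdivrMr.
Qed.

Fact bop_scC c A : A * bop_sc c = bop_sc c * A.
Proof. by rewrite bop_scM /bop_sc bop_scaler mulr1. Qed.

Fact bop_imC A : A * ('i *: (1 : bop H)) = ('i *: (1 : bop H)) * A.
Proof. by rewrite bop_scalel mul1r bop_scaler mulr1. Qed.

Fact bop_imMim : ('i *: (1 : bop H)) * ('i *: (1 : bop H)) = - 1.
Proof. by rewrite bop_scalel mul1r scalerA -expr2 sqr_i scaleN1r. Qed.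

Fact bop_nrm_eq0 A : bop_nrm A = 0 -> A = 0.
Proof.
move=> A0; apply: bop_eqP => x; apply/eqP; rewrite -normr_le0.
by have := bop_nrmP A x; rewrite A0 mul0r.
Qed.

Fact bop_nrmD A B : bop_nrm (A + B) <= bop_nrm A + bop_nrm B.
Proof.
apply: bop_nrm_le => [|x]; first by rewrite addr_ge0 ?bop_nrm_ge0.
rewrite bopE rmorphD mulrDl; apply: le_trans (ler_normD _ _) _.
by apply: lerD; exact: bop_nrmP.
Qed.

Fact bop_nrmM A B : bop_nrm (A * B) <= bop_nrm A * bop_nrm B.
Proof.
apply: bop_nrm_le => [|x]; first by rewrite mulr_ge0 ?bop_nrm_ge0.
rewrite bopE rmorphM -mulrA; apply: le_trans (bop_nrmP _ _) _.
by apply: ler_wpM2l; [rewrite lecR bop_nrm_ge0 | exact: bop_nrmP].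
Qed.

Fact bop_nrm_sc c : bop_nrm (bop_sc c) <= `|c|.
Proof.
apply: bop_nrm_le => // x; rewrite /bop_sc !bopE normrZ normc_def /= expr0n addr0.
by rewrite sqrtr_sqr.
Qed.

Fact bop_nrm_im : bop_nrm ('i *: (1 : bop H)) <= 1.
Proof.
apply: bop_nrm_le => // x; rewrite !bopE normrZ normc_def /= expr0n add0r.
by rewrite expr1n sqrtr1.
Qed.

Definition bop_sa A := forall x y, inner (A x) y = inner x (A y) :> R[i].

Fact bop_sa_sc c : bop_sa (bop_sc c).
Proof. by move=> x y; rewrite /bop_sc !bopE innerZl innerZr cstar_conjR. Qed.

Fact bop_saD A B : bop_sa A -> bop_sa B -> bop_sa (A + B).
Proof. by move=> sA sB x y; rewrite !bopE innerDl innerDr sA sB. Qed.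

Fact bop_sa_jordan A B : bop_sa A -> bop_sa B -> bop_sa (A * B + B * A).
Proof.
by move=> sA sB x y; rewrite !bopE innerDl innerDr !(sA, sB) addrC.
Qed.

Fact bop_sa_lie A B : bop_sa A -> bop_sa B ->
  bop_sa (('i *: (1 : bop H)) * (A * B - B * A)).
Proof.
move=> sA sB x y; rewrite !bopE innerZl innerZr cstar_conji.
rewrite innerDl innerDr innerNl innerNr !(sA, sB).
by rewrite mulNr -mulrN opprB.
Qed.

Fact bop_sa_inv A B : bop_sa A -> is_inverse A B -> bop_sa B.
Proof.
move=> sA [AB BA] x y.
have ABE z : A (B z) = z by rewrite -bopME AB.
by rewrite -{1}[y]ABE -sA ABE.
Qed.

Fact bop_sa_lim A :
  (forall e : R, 0 < e -> exists B, bop_sa B /\ bop_nrm (A - B) <= e) -> bop_sa A.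
Proof.
move=> Al x y; apply/eqP; rewrite -subr_eq0 -normr_le0.
have nE z : `|z : H| = (complex.Re `|z|)%:C by rewrite RRe_real // normr_real.
pose k := 2 * (complex.Re `|x| * complex.Re `|y|) + 1.
have k0 : 0 < k.
  by rewrite ltr_wpDl // mulr_ge0 // mulr_ge0 // -lecR -nE normr_ge0.
apply/ler_addgt0Pr => e e0; have eE : e = (complex.Re e)%:C.
  by rewrite RRe_real // gtr0_real.
have e1 : 0 < complex.Re e by rewrite -ltcR -eE.
have [B [sB AB]] := Al (complex.Re e / k) (divr_gt0 e1 k0).
have -> : inner (A x) y - inner x (A y) =
    inner ((A - B) x) y - inner x ((A - B) y).
  by rewrite !bopE innerDl innerDr innerNl innerNr sB; ring.
have le z : `|(A - B) z| <= (complex.Re e / k)%:C * `|z|.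
  by apply: le_trans (bop_nrmP _ _) _; rewrite ler_wpM2r // lecR.
rewrite add0r; apply: le_trans (ler_normB _ _) _.
apply: le_trans (lerD (norm_inner_le _ _) (norm_inner_le _ _)) _.
apply: le_trans (lerD (ler_wpM2r (normr_ge0 _) (le x))
                      (ler_wpM2l (normr_ge0 _) (le y))) _.
rewrite [leRHS]eE (nE x) (nE y) -!rmorphM -rmorphD lecR.
have -> : complex.Re e / k * complex.Re `|x| * complex.Re `|y| +
    complex.Re `|x| * (complex.Re e / k * complex.Re `|y|) =
    complex.Re e * (1 - k^-1).
  by rewrite /k; field; rewrite gt_eqF.
by rewrite ger_pMr // lerBlDr lerDl invr_ge0 ltW.
Qed.

(** By commutation the squared norm of [(A + 'i B) x] is the quadratic form of [A ^ 2 + B ^ 2] at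
    [x]. *)
Fact bop_nrm_normal A B : bop_sa A -> bop_sa B -> A * B = B * A ->
  bop_nrm (A + ('i *: (1 : bop H)) * B) ^+ 2 <= bop_nrm (A * A + B * B).
Proof.
move=> sA sB AB; set N := bop_nrm (A * A + B * B).
have N0 : 0 <= N by exact: bop_nrm_ge0.
rewrite -[leRHS](sqr_sqrtr N0) ler_pXn2r ?nnegrE ?bop_nrm_ge0 ?sqrtr_ge0 //.
apply: bop_nrm_le => [|x]; first exact: sqrtr_ge0.
have e : inner (A (A x) + B (B x)) x = `|A x + 'i *: B x| ^+ 2.
  rewrite -innerxx !innerDl !innerDr !innerZl !innerZr !(sA, sB) cstar_conji.
  rewrite -!bopME AB.
  have ii : 'i * 'i = -1 :> R[i] by rewrite -expr2 sqr_i.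
  apply/eqP; rewrite -subr_eq0; apply/eqP.
  transitivity ((1 + 'i * 'i) * inner x ((B * B) x)); first by ring.
  by rewrite ii subrr mul0r.
rewrite -(ler_pXn2r (ltn0Sn 1)) ?nnegrE ?mulr_ge0 ?lecR ?sqrtr_ge0 //.
rewrite !bopE -e exprMn -rmorphXn /= sqr_sqrtr // expr2 mulrA.
apply: le_trans (ler_wpM2r (normr_ge0 _) (bop_nrmP _ _)).
by rewrite !bopE; apply: inner_ge0_le; rewrite e exprn_ge0.
Qed.

(** The pointwise limit is approached at a rate proportional to [|x|], so it is bounded and is a
    limit in operator norm. *)
Fact bop_complete (y : nat -> bop H) (C r : R) : 0 <= r < 1 ->
    (forall n, bop_nrm (y n.+1 - y n) <= C * r ^+ n) ->
  exists l, forall e, 0 < e -> exists N, forall n, (N <= n)%N ->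
    bop_nrm (l - y n) <= e.
Proof.
move=> r01 yC; have nE z : `|z : H| = (complex.Re `|z|)%:C.
  by rewrite RRe_real // normr_real.
have C0 : 0 <= C.
  by have := le_trans (bop_nrm_ge0 _) (yC 0%N); rewrite expr0 mulr1.
have /choice[f fP] : forall x, exists l : H, (fun n => y n x) @ \oo --> l /\
    forall n, `|l - y n x| <= (C / (1 - r) * r ^+ n)%:C * `|x|.
  move=> x; have [|l yl lb] := @geometric_cvg R H (fun n => y n x)
    (C * complex.Re `|x|) r r01.
    move=> n; have := bop_nrmP (y n.+1 - y n) x; rewrite !bopE => /le_trans; apply.
    by rewrite mulrAC rmorphM /= -nE ler_wpM2r // lecR.
  exists l; split=> // n; apply: le_trans (lb n) _.
  by rewrite [in leRHS]nE -rmorphM lecR le_eqVlt; apply/orP; left; apply/eqP; ring.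
have fb : f \in @bounded_op R H.
  apply/bounded_opP; split.
    move=> a x z; apply: (@cvg_unique _ (@norm_hausdorff _ H) _ _ _ _ (fP _).1).
    have -> : (fun n => y n (a *: x + z)) = (fun n => a *: y n x + y n z).
      by apply/funext => n; rewrite bopD bopZ.
    apply: cvgD; last exact: (fP _).1.
    by apply: cvgZr; exact: (fP _).1.
  exists (C / (1 - r) + bop_nrm (y 0%N)) => x.
  have := (fP x).2 0%N; rewrite expr0 mulr1 => fx.
  rewrite -(subrK (y 0%N x) (f x)) rmorphD mulrDl.
  apply: le_trans (ler_normD _ _) _; apply: lerD => //; exact: bop_nrmP.
exists (Bop fb) => e e0; have K0 : 0 <= C / (1 - r).
  by rewrite divr_ge0 // subr_ge0 ltW //; case/andP: r01.
have : (fun n => C / (1 - r) * r ^+ n) @ \oo --> (0 : R).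
  rewrite -[X in _ --> X](mulr0 (C / (1 - r))).
  by apply: cvgMr; apply: cvg_expr; case/andP: r01 => r0 r1; rewrite ger0_norm.
move/cvgrPdist_lt => /(_ e e0)[N _ yN]; exists N => n Nn.
apply: bop_nrm_le => [|x]; first exact: ltW.
rewrite !bopE; apply: le_trans ((fP x).2 n) _; rewrite ler_wpM2r // lecR.
have := yN _ Nn; rewrite /= sub0r normrN => /ltW/(le_trans (ler_norm _)).
by [].
Qed.

Definition bop_opalg : opalg R (bop H) :=
  @Opalg R (bop H) bop_sc bop_scC _ bop_imC bop_imMim bop_nrm
    bop_nrm_ge0 bop_nrm_eq0 bop_nrmD bop_nrmM bop_nrm_sc
    bop_nrm_im bop_sa bop_sa_sc bop_saD bop_sa_jordan bop_sa_lie
    bop_sa_inv bop_sa_lim bop_nrm_normal bop_complete.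

Lemma bop_scBE c A x : (sc bop_opalg c - A) x = c%:C *: x - A x.
Proof. by []. Qed.

(** Polarization: the defect [D] of symmetry vanishes on the diagonal, hence is antisymmetric;
    replacing [x] by ['i x] makes it symmetric too, so it is 0. *)
Lemma bop_ge0_sa A : bop_ge0 A -> bop_sa A.
Proof.
move=> A0; pose D x y : R[i] := inner (A x) y - inner x (A y).
have D0 x : D x x = 0.
  rewrite /D [X in _ - X]innerC; apply/eqP; rewrite subr_eq0 eq_sym.
  by apply/eqP/CrealP/ger0_real/A0.
have DD x y : D x y + D y x = 0.
  have := D0 (x + y); have := D0 x; have := D0 y.
  rewrite /D !bopD !innerDl !innerDr => e1 e2 e3.
  by rewrite -[RHS]e3 -[LHS]addr0 -{1}e1 -[LHS]addr0 -{1}e2; ring.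
move=> x y; apply/eqP; rewrite -subr_eq0 -/(D x y); apply/eqP.
have e1 := DD x y; have := DD ('i *: x) y.
have -> : D ('i *: x) y = 'i * D x y.
  by rewrite /D bopZ !innerZl mulrBr.
have -> : D y ('i *: x) = - 'i * D y x.
  by rewrite /D bopZ !innerZr cstar_conji mulrBr.
have -> : D y x = - D x y by apply/eqP; rewrite -addr_eq0 addrC e1.
rewrite mulrNN -mulr2n -mulrnAr => /eqP; rewrite mulf_eq0 mulrn_eq0 /=.
case/orP => [/eqP i0|/eqP //].
by move: i0 => [] /eqP; rewrite oner_eq0.
Qed.

(** Both directions go through the bound [nrm (t - A) <= t], by [nrm_pos] and [pos_nrm]. *)
Lemma bop_ge0P A : bop_ge0 A <-> pos bop_opalg A.
Proof.
split=> [A0|pA x].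
  have sA := bop_ge0_sa A0.
  pose t := bop_nrm A + 1; have t0 : 0 < t by rewrite ltr_wpDl ?bop_nrm_ge0.
  have At z : inner (A z) z <= t%:C * `|z| ^+ 2.
    apply: le_trans (inner_ge0_le (A0 z)) _; rewrite expr2 mulrA ler_wpM2r //.
    apply: le_trans (bop_nrmP _ _) _; rewrite ler_wpM2r // lecR.
    by rewrite lerDl.
  apply: (@nrm_pos _ _ bop_opalg A t sA); apply: bop_nrm_le => [|x]; first exact: ltW.
  rewrite -(ler_pXn2r (ltn0Sn 1)) ?nnegrE ?mulr_ge0 ?lecR ?(ltW t0) //.
  set q := inner (A x) x; set n := `|A x| ^+ 2.
  have tC : 0 < t%:C :> R[i] by rewrite ltcR.
  (* The form of [A] at [t x - A x] is [t ^ 2 q - 2 t n] plus the form at [A x], which is at most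
     [t n]. *)
  have nq : n <= t%:C * q.
    have := A0 (t%:C *: x - A x).
    rewrite bopD -scaleN1r !bopZ !innerDl !innerDr !innerZl !innerZr.
    rewrite !cstar_conjR rmorphN1 !(sA _ x) -(sA x x) !innerxx -/n -/q => h.
    rewrite -subr_ge0 -(pmulr_rge0 _ tC); apply: le_trans h _.
    rewrite -subr_ge0 [X in 0 <= X](_ : _ =
      t%:C * n - inner (A (A x)) (A x)); last by ring.
    by rewrite subr_ge0; exact: At.
  have q0 : 0 <= t%:C * q by apply: le_trans nq; rewrite exprn_ge0.
  rewrite -innerxx bop_scBE !innerDl !innerDr !innerNl !innerNr.
  rewrite !innerZl !innerZr !cstar_conjR !innerxx -(sA x x) -/q -/n.
  rewrite -subr_ge0 [X in 0 <= X](_ : _ = t%:C * q + (t%:C * q - n)); last by ring.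
  by rewrite addr_ge0 // subr_ge0.
have sA : bop_sa A := pA.1.
have := pos_nrm pA (lexx _); rewrite -/(bop_nrm A); set N := bop_nrm A => NA.
have pR : inner (A x) x \is Num.real.
  by apply/CrealP; rewrite -innerC sA.
have : inner ((sc bop_opalg N - A) x) x <= N%:C * `|x| ^+ 2.
  rewrite expr2 mulrA; apply: le_trans (real_ler_norm _) _.
    rewrite bop_scBE innerDl innerNl innerZl innerxx.
    by rewrite rpredB // rpredM ?complex_real // rpredX // normr_real.
  apply: le_trans (norm_inner_le _ _) _; rewrite ler_wpM2r //.
  by apply: le_trans (bop_nrmP _ _) _; rewrite ler_wpM2r // lecR.
rewrite bop_scBE innerDl innerNl innerZl innerxx.
by rewrite gerBl.
Qed.

End BoundedOperators.

(** * The zero Hilbert space and the return to operators *)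

Lemma bop_ge0_scalar (R : realType) (H : hilbertType R) (x : H) (c : R) :
  x != 0 -> bop_ge0 (c%:C *: (1 : bop H)) -> 0 <= c.
Proof.
move=> x0 /(_ x); rewrite !bopE innerZl innerxx pmulr_lge0 ?lecR //.
by rewrite exprn_gt0 // normr_gt0.
Qed.

(** For the zero Hilbert space, where [Phi 1 = 1] forces [1 = 0] in [U]. *)
Lemma cstar_ge0_trivial (R : realType) (U : cstarAlgType R) (a : U) :
  (1 : U) = 0 -> cstar_ge0 a.
Proof.
move=> U0; have all0 (x : U) : x = 0 by rewrite -[x]mulr1 U0 mulr0.
split; first by rewrite (all0 (star a)) (all0 a).
move=> z /= []; exists 0.
by split; rewrite [LHS]all0 [RHS]all0.
Qed.

Theorem theorem3 (R : realType) (H : hilbertType R) (U : cstarAlgType R)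
    (Phi : {linear bop H -> U}) (Phi_pos : positive_map Phi)
    (Phi_unital : Phi 1 = 1)
    (A B : bop H) (A_pos : bop_ge0 A) (B_pos : bop_ge0 B)
    (m m' M' M : R) (m_gt0 : 0 < m)
    (mA : bop_le (m%:C *: (1 : bop H)) A) (Am' : bop_le A (m'%:C *: (1 : bop H)))
    (m'M' : bop_le (m'%:C *: (1 : bop H)) (M'%:C *: (1 : bop H)))
    (M'B : bop_le (M'%:C *: (1 : bop H)) B) (BM : bop_le B (M%:C *: (1 : bop H))) :
  let h := M / m in
  let c := kantorovich h ^+ 2 / (1 + ln (M' / m') ^+ 2 / 8) ^+ 2 in
  cstar_le (Phi (2^-1 *: (A + B)) ^+ 2) (c%:C *: Phi (bop_gmean A B) ^+ 2) /\
  cstar_le (Phi (2^-1 *: (A + B)) ^+ 2)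
           (c%:C *: cstar_gmean (Phi A) (Phi B) ^+ 2).
Proof.
move=> h c.
(* The scalar inequalities between [m], [m'], [M'] and [M] are read off from the operator ones at a
   nonzero vector. *)
have [[x x0]|H0] := pselect (exists x : H, x != 0); last first.
  have U0 : (1 : U) = 0.
    rewrite -Phi_unital -(linear0 Phi); congr (Phi _); apply: bop_eqP => x.
    apply: contrapT => /eqP x0; apply: H0; exists x; apply: contra x0.
    by move=> /eqP ->; rewrite bop0.
  by split; apply: cstar_ge0_trivial.
have scal a b : bop_le (a%:C *: (1 : bop H)) (b%:C *: (1 : bop H)) -> a <= b.
  rewrite /bop_le -scalerBl -rmorphB => /(bop_ge0_scalar x0).
  by rewrite subr_ge0.
have le_tr (X Y Z : bop H) : bop_le X Y -> bop_le Y Z -> bop_le X Z.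
  move=> /bop_ge0P XY /bop_ge0P YZ; apply/bop_ge0P.
  by have := posD YZ XY; rewrite addrA subrK.
have mm' := scal _ _ (le_tr _ _ _ mA Am').
have mM' := scal _ _ m'M'.
have M'M := scal _ _ (le_tr _ _ _ M'B BM).
have mB := le_tr _ _ _ mA (le_tr _ _ _ Am' (le_tr _ _ _ m'M' M'B)).
have AM := le_tr _ _ _ Am' (le_tr _ _ _ m'M' (le_tr _ _ _ M'B BM)).
have m'0 : 0 < m' by lra.
have M0 : 0 < M by lra.
have PhiZ (a : R) (X : bop H) :
    Phi (sc (bop_opalg H) a * X) = sc (cstar_opalg U) a * Phi X.
  by rewrite /= bop_scM cstar_scM linearZ.
have Phip (X : bop H) : pos (bop_opalg H) X -> pos (cstar_opalg U) (Phi X).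
  by move=> /bop_ge0P/Phi_pos/cstar_ge0P.
have toP (X : bop H) := (bop_ge0P X).1.
have [] := sqr_mean_le_sqr_gmean (linearD Phi) PhiZ Phi_unital Phip
  (@bop_ge0P R H) (@cstar_ge0P R U) m_gt0 m'0 mM' M0 (toP _ mA) (toP _ Am')
  (toP _ M'B) (toP _ BM) (toP _ mB) (toP _ AM).
have -> : sc (bop_opalg H) 2^-1 * (A + B) = 2^-1 *: (A + B).
  by rewrite /= bop_scM fmorphV rmorph_nat.
rewrite -!expr2 -/h -/c !cstar_scM => le1 le2.
by split; apply/cstar_ge0P.
Qed.
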